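(* Let $k$ be a normalized complete Nevanlinna-Pick kernel on a set $\Omega$, with reproducing kernel Hilbert space $\mathcal H(k)$. If $\{h_i\}_{i\ge1}$ is a sequence in $\mathcal H(k)$ with $\sum_{i=1}^\infty\|h_i\|^2<\infty$, then there exist multipliers $a,b_1,b_2,\dots\in Mult(\mathcal H(k))$ such that: (i) $a$ is outer, i.e. $a\mathcal H(k)$ is dense in $\mathcal H(k)$; (ii) for each $i$, $h_i=\dfrac{b_i}{a}$; (iii) the column $\begin{pmatrix} a \\ b_1 \\ b_2 \\ \vdots \end{pmatrix}$ is a contractive multiplier, i.e. $\|af\|^2+\sum_{i=1}^\infty\|b_if\|^2\le\|f\|^2$ for all $f\in\mathcal H(k)$; (iv) $1/a\in\mathcal H(k)$ and $\|1/a\|^2_{\mathcal H(k)}\le1+\sum_{i=1}^\infty\|h_i\|^2_{\mathcal H(k)}$.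
   Context: A normalized complete Nevanlinna-Pick (CNP) kernel on a set $\Omega$ is a function $k:\Omega\times\Omega\to\mathbb C$ of the form $k(x,y)=\dfrac{1}{1-u(x)u(y)^*}$, where $u$ is a function from $\Omega$ into the open unit ball $\mathbb B^d$ of $\mathbb C^d$; here $d=\infty$ is allowed, in which case $u$ maps into the open unit ball of $\ell^2(\mathbb N)$. Here $zw^*=\sum_jz_j\overline{w_j}$. $Mult(\mathcal H(k))$ is the algebra of functions on $\Omega$ which multiply $\mathcal H(k)$ into itself boundedly. *)

(* Defs.v *)
From HB Require Import structures.
From mathcomp Require Import all_boot all_order all_algebra complex.
From mathcomp Require Import all_classical all_reals all_analysis.
Set Implicit Arguments.
Unset Strict Implicit.
Unset Printing Implicit Defensive.
Import Order.TTheory GRing.Theory Num.Theory Num.Def.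
Import numFieldNormedType.Exports.
Local Open Scope classical_set_scope.
Local Open Scope ring_scope.

(* z w^* for z, w in C^d *)
Definition pairing_fin (R : realType) (d : nat) (z w : 'rV[R[i]]_d) : R[i] :=
  \sum_(j < d) z 0 j * (w 0 j)^*.

Definition ball_fin (R : realType) (d : nat) (z : 'rV[R[i]]_d) : Prop :=
  \sum_(j < d) `|z 0 j| ^+ 2 < 1.

(* z w^* for z, w in l^2(N); the limit exists by Cauchy-Schwarz. The regular
   algebra R[i]^o carries the usual topology of the complex numbers. *)
Definition pairing_l2 (R : realType) (z w : nat -> R[i]) : R[i] :=
  limn (series (fun j => z j * (w j)^* : R[i]^o)).

(* The open unit ball of l^2(N). The modulus is an element of R[i], and
   complex.Re turns it into a real number. *)
Definition ball_l2 (R : realType) (z : nat -> R[i]) : Prop :=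
  (\sum_(0 <= j <oo) ((complex.Re `|z j|) ^+ 2)%:E < 1%:E)%E.

Definition normalized_CNP (R : realType) (Omega : Type)
    (k : Omega -> Omega -> R[i]) : Prop :=
  (exists (d : nat) (u : Omega -> 'rV[R[i]]_d),
     (forall x, ball_fin (u x)) /\
     (forall x y, k x y = 1 / (1 - pairing_fin (u x) (u y)))) \/
  (exists u : Omega -> nat -> R[i],
     (forall x, ball_l2 (u x)) /\
     (forall x y, k x y = 1 / (1 - pairing_l2 (u x) (u y)))).

(* A Hilbert space of functions on Omega with reproducing kernel k. The
   elements of the Hilbert space are identified with functions on Omega by the
   injective linear map rkhs_fun; by the Moore-Aronszajn theorem k determines
   the space, as a space of functions, and its norm. *)
Record rkhs (R : realType) (Omega : Type) (k : Omega -> Omega -> R[i]) := RKHS {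
  rkhs_space :> completeNormedModType R[i];
  rkhs_dot : {dot rkhs_space for @conjC R[i]};
  rkhs_dotE : forall f : rkhs_space, `|f| ^+ 2 = rkhs_dot f f;
  rkhs_fun : {linear rkhs_space -> (Omega -> R[i])};
  rkhs_fun_inj : injective rkhs_fun;
  rkhs_ker : Omega -> rkhs_space;
  rkhs_kerE : forall x y, rkhs_fun (rkhs_ker y) x = k x y;
  rkhs_reproducing : forall (f : rkhs_space) (y : Omega),
    rkhs_fun f y = rkhs_dot f (rkhs_ker y)
}.

(* The norm of a normed module over R[i] takes its values in R[i]. *)
Definition hnorm (R : realType) (V : normedModType R[i]) (f : V) : R :=
  complex.Re `|f|.

(* An element of Mult(H): the operator mult_op is determined by the function
   mult_fun, because rkhs_fun is injective. *)
Record multiplier (R : realType) (Omega : Type) (k : Omega -> Omega -> R[i])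
    (H : rkhs k) := Multiplier {
  mult_fun :> Omega -> R[i];
  mult_op : H -> H;
  mult_opE : forall (f : H) (x : Omega),
    rkhs_fun H (mult_op f) x = mult_fun x * rkhs_fun H f x;
  mult_bounded : exists M : R, forall f : H, hnorm (mult_op f) <= M * hnorm f
}.

Definition outer (R : realType) (Omega : Type) (k : Omega -> Omega -> R[i])
    (H : rkhs k) (a : multiplier H) : Prop :=
  dense (range (mult_op a)).

(* Main.v *)
Require Import Defs.
From HB Require Import structures.
From mathcomp Require Import all_boot all_order all_algebra complex.
From mathcomp Require Import all_classical all_reals all_analysis.
From mathcomp Require Import ring lra.
Set Implicit Arguments.
Unset Strict Implicit.
Unset Printing Implicit Defensive.
Import Order.TTheory GRing.Theory Num.Theory Num.Def.
Import numFieldNormedType.Exports.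
Local Open Scope classical_set_scope.
Local Open Scope ring_scope.

(* Identify H(k) with a quotient of the full Fock space F^2 through the kernel
   vectors kap_x = sum_w conj(u(x)^w) e_w, which satisfy <kap_y, kap_x> = k(x, y),
   and lift each h_i to a vector of F^2 of no larger norm.  In F^2 (x) l^2 let E
   be the component of the column F = (1, h_1, h_2, ...) orthogonal to all its
   proper shifts.  The constant coefficient 1 of F forces E <> 0; the shifts of
   the normalized E are orthonormal, so E acts as an isometric column, and by the
   Wold decomposition F = E g with |g| = |F|.  Evaluating at the points u(x), E
   becomes the contractive column (a, b_1, b_2, ...), and F = E g becomes
   1 = a g, whereas b_i = h_i a because E is a limit of vectors F p with p
   polynomial.  Finally a is outer because a (g p) = p for all polynomials p. *)

(** * Hilbert spaces and isometric relations *)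

(** Noncommuting variables are what makes the factorization available: on H(k) itself multiplication
    by a coordinate of u is in general not isometric, whereas the shifts of F^2 are isometries with
    mutually orthogonal ranges. Nothing is lost, because evaluation at x turns the shift by a word w
    into multiplication by the scalar u(x)^w. The operators involved (lifting, evaluation, p -> E p
    and its adjoint) are partial isometries prescribed on generators x_j -> y_j with equal Gram
    matrices. They are never built as maps: the closed span of the pairs (x_j, y_j) in X x Y is a
    relation, and one projection argument on it produces a vector together with its image. Real
    parts suffice there, since the spans contain all complex multiples of the generators. The 1 in
    (iv) is the squared norm of the constant entry of F. *)

(* A complex Hilbert space, seen as a real one: [r] is the real part of the inner
   product, invariant under multiplication by [i]; completeness is stated with
   squared norms, and no definiteness is required. *)
Record hilbert (R : realType) (V : lmodType R[i]) (r : V -> V -> R) : Prop :=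
  Hilbert {
  dotC : forall u v, r u v = r v u;
  dotDl : forall u v w, r (u + v) w = r u w + r v w;
  dotZl : forall t u v, r (t%:C%C *: u) v = t * r u v;
  dotii : forall u v, r ('i%C *: u) ('i%C *: v) = r u v;
  dot_ge0 : forall u, 0 <= r u u;
  dot_complete : forall s : nat -> V,
    (forall e, 0 < e -> exists N, forall m n, (N <= m)%N -> (N <= n)%N ->
       r (s m - s n) (s m - s n) < e) ->
    exists l, forall e, 0 < e -> exists N, forall n, (N <= n)%N ->
       r (s n - l) (s n - l) < e }.

(** * Elementary inequalities *)

Section real_lemmas.
Variable R : realType.
Implicit Types a b c e : R.

(** A large t excludes c < 0, c = 0 forces b = 0, and otherwise t = - b / c is the minimizer. Serves
    for Cauchy-Schwarz and for the near-orthogonality of near-minimizers. *)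
Lemma discriminant_le a b c : (forall t, 0 <= a + 2 * t * b + t ^+ 2 * c) ->
  b ^+ 2 <= a * c.
Proof.
move=> H; have a0 : 0 <= a by have := H 0; rewrite mulr0 mul0r expr0n mul0r !addr0.
have c0 : 0 <= c.
  rewrite leNgt; apply/negP => c0.
  (* Gives t >= 1 and t * - c = a + 2 |b| + 1 - c, so that the negative quadratic term outweighs the
     other two. *)
  pose t := (a + 2 * `|b| + 1) / (- c) + 1.
  have nc : 0 < - c by rewrite oppr_gt0.
  have t1 : 1 <= t by rewrite lerDr divr_ge0 // ?ltW // ; have := normr_ge0 b; lra.
  have tc : t * - c = a + 2 * `|b| + 1 - c.
    by rewrite mulrDl mul1r divfK ?gt_eqF //.
  have hb : b <= `|b| := ler_norm b.
  have := H t; rewrite leNgt => /negP; apply.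
  have -> : a + 2 * t * b + t ^+ 2 * c = a + 2 * t * b - t * (t * - c) by ring.
  rewrite tc.
  have h1 : t * b <= t * `|b| by apply: ler_wpM2l => //; lra.
  have h2 : a <= t * a by rewrite ler_peMl.
  have h3 : 0 < t * (1 - c) by apply: mulr_gt0; lra.
  have -> : t * (a + 2 * `|b| + 1 - c) = t * a + 2 * (t * `|b|) + t * (1 - c) by ring.
  lra.
have [c_eq0|c_neq0] := eqVneq c 0.
  rewrite c_eq0 mulr0 in H *; have [->|b0] := eqVneq b 0; first by rewrite expr0n.
  exfalso; have := H (- (a + 1) / (2 * b)).
  have -> : 2 * (- (a + 1) / (2 * b)) * b = - (a + 1) by field.
  by rewrite mulr0; lra.
have cp : 0 < c by rewrite lt_def c_neq0.
have := H (- b / c).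
have -> : a + 2 * (- b / c) * b + (- b / c) ^+ 2 * c = (a * c - b ^+ 2) / c.
  by field.
by rewrite pmulr_lge0 ?invr_gt0 // subr_ge0.
Qed.

Lemma le0_mulP a c : 0 <= c -> (forall e, 0 < e -> a <= e * c) -> a <= 0.
Proof.
move=> c0 H; rewrite leNgt; apply/negP => a0.
have cp : 0 < c + 1 by lra.
have := H (a / (c + 1)) (divr_gt0 a0 cp).
rewrite leNgt => /negP; apply.
by rewrite -mulrAC ltr_pdivrMr // ltr_pM2l //; lra.
Qed.

Lemma le_addmul a b c : 0 <= c -> (forall e, 0 < e -> a <= b + e * c) -> a <= b.
Proof.
move=> c0 H; rewrite -subr_le0; apply: (le0_mulP c0) => e e0.
by have := H e e0; lra.
Qed.

End real_lemmas.

Section hilbert_theory.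
Variables (R : realType) (V : lmodType R[i]) (r : V -> V -> R).
Hypothesis hr : hilbert r.
Implicit Types (u v w : V) (t e : R).
Local Notation N u := (r u u).

Lemma dotDr u v w : r u (v + w) = r u v + r u w.
Proof. by rewrite !(dotC hr u) (dotDl hr). Qed.

Lemma dotZr t u v : r u (t%:C%C *: v) = t * r u v.
Proof. by rewrite !(dotC hr u) (dotZl hr). Qed.

Lemma dotNl u v : r (- u) v = - r u v.
Proof.
have -> : - u = (-1)%:C%C *: u by rewrite rmorphN1 scaleN1r.
by rewrite (dotZl hr) mulN1r.
Qed.

Lemma dotNr u v : r u (- v) = - r u v.
Proof. by rewrite !(dotC hr u) dotNl. Qed.

Lemma dot0l u : r 0 u = 0.
Proof. by rewrite -(scale0r 0) -[0]/(0%:C%C) (dotZl hr) mul0r. Qed.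

Lemma dot0r u : r u 0 = 0.
Proof. by rewrite (dotC hr) dot0l. Qed.

Lemma scaleii u : 'i%C *: ('i%C *: u) = - u.
Proof. by rewrite scalerA -expr2 sqr_i scaleN1r. Qed.

Lemma dotil u v : r ('i%C *: u) v = - r u ('i%C *: v).
Proof. by rewrite -[LHS](dotii hr) scaleii dotNl. Qed.

Lemma dot_i u : r u ('i%C *: u) = 0.
Proof. by have := dotil u u; rewrite (dotC hr); lra. Qed.

Lemma scale_complexE (c : R[i]) u :
  c *: u = (complex.Re c)%:C%C *: u + (complex.Im c)%:C%C *: ('i%C *: u).
Proof. by rewrite {1}[c]complexE scalerDl scalerA [X in _ + X *: _]mulrC. Qed.

Lemma normD u v : N (u + v) = N u + 2 * r u v + N v.
Proof. by rewrite !(dotDl hr) !dotDr (dotC hr v u); ring. Qed.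

Lemma normZ t u : N (t%:C%C *: u) = t ^+ 2 * N u.
Proof. by rewrite (dotZl hr) dotZr; ring. Qed.

Lemma normN u : N (- u) = N u.
Proof. by rewrite dotNl dotNr opprK. Qed.

Lemma norm_distC u v : N (u - v) = N (v - u).
Proof. by rewrite -normN opprB. Qed.

Lemma parallelogram u v : N (u + v) + N (u - v) = 2 * N u + 2 * N v.
Proof. by rewrite !normD normN dotNr; ring. Qed.

Lemma normD_le u v : N (u + v) <= 2 * N u + 2 * N v.
Proof. by rewrite -parallelogram lerDl (dot_ge0 hr). Qed.

Lemma normB_le w u v : N (u - v) <= 2 * N (u - w) + 2 * N (w - v).
Proof. by have := normD_le (u - w) (w - v); rewrite subrKA. Qed.

Lemma cauchy_schwarz u v : r u v ^+ 2 <= N u * N v.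
Proof.
apply: discriminant_le => t; have := dot_ge0 hr (u + t%:C%C *: v).
by rewrite normD normZ dotZr mulrA.
Qed.

End hilbert_theory.

(** Real scalars only: the projection argument asks for no more, and complex spans are real spans of
    generators stable under complex multiples, as in [family_span]. *)
Definition real_subspace (R : realType) (V : lmodType R[i]) (S : set V) : Prop :=
  S 0 /\ forall (t : R) u v, S u -> S v -> S (u + t%:C%C *: v).

Inductive real_span (R : realType) (V : lmodType R[i]) (G : set V) : V -> Prop :=
| real_span0 : real_span G 0
| real_spanA (t : R) u v : real_span G u -> G v -> real_span G (u + t%:C%C *: v).

Definition dot_closure (R : realType) (V : lmodType R[i]) (r : V -> V -> R)
    (S : set V) : set V :=
  [set v | forall e, 0 < e -> exists2 s, S s & r (v - s) (v - s) < e].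

Section closure.
Variables (R : realType) (V : lmodType R[i]) (r : V -> V -> R).
Hypothesis hr : hilbert r.
Implicit Types (u v w : V) (S T G : set V) (t e : R).
Local Notation N u := (r u u).

Lemma real_subspaceD S u v : real_subspace S -> S u -> S v -> S (u + v).
Proof. by move=> -[_ h] Su /(h 1 _ _ Su); rewrite rmorph1 scale1r. Qed.

Lemma real_subspaceZ S t u : real_subspace S -> S u -> S (t%:C%C *: u).
Proof. by move=> -[S0 h] /(h t _ _ S0); rewrite add0r. Qed.

Lemma real_subspaceB S u v : real_subspace S -> S u -> S v -> S (u - v).
Proof. by move=> -[_ h] Su /(h (-1) _ _ Su); rewrite rmorphN1 scaleN1r. Qed.

Lemma real_span_subspace G : real_subspace (real_span G).
Proof.
split; first exact: real_span0.
move=> t u v hu; elim=> [|t' v' w _ ih Gw]; first by rewrite scaler0 addr0.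
by rewrite scalerDr addrA scalerA -rmorphM; exact: real_spanA.
Qed.

Lemma mem_real_span G v : G v -> real_span G v.
Proof.
by move=> /(real_spanA 1 (real_span0 G)); rewrite rmorph1 scale1r add0r.
Qed.

Lemma real_span_min G S : real_subspace S -> G `<=` S -> real_span G `<=` S.
Proof. by move=> [S0 h] GS v; elim=> // t u w _ Su /GS; exact: h. Qed.

Lemma subset_dot_closure S : S `<=` dot_closure r S.
Proof. by move=> v Sv e e0; exists v => //; rewrite subrr (dot0l hr). Qed.

Lemma dot_closure_idem S : dot_closure r (dot_closure r S) `<=` dot_closure r S.
Proof.
move=> v Sv e e0; have e4 : 0 < e / 4 by lra.
have [w Sw vw] := Sv _ e4; have [s Ss ws] := Sw _ e4; exists s => //.
by have := normB_le hr w v s; lra.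
Qed.

Lemma dot_closureS S T : S `<=` T -> dot_closure r S `<=` dot_closure r T.
Proof. by move=> ST v Sv e /Sv[s /ST Ts h]; exists s. Qed.

Lemma dot_closure_subspace S : real_subspace S -> real_subspace (dot_closure r S).
Proof.
move=> hS; split; first by apply: subset_dot_closure; case: hS.
move=> t u v Su Sv e e0.
(* With d this quotient, 2 d + 2 (1 + t^2) d = e, which leaves room for the 2 d + 2 t^2 d given by
   [normD_le]. *)
have d0 : 0 < e / (2 * (2 + t ^+ 2)).
  by rewrite divr_gt0 // mulr_gt0 //; have := sqr_ge0 t; lra.
have [s Ss us] := Su _ d0; have [s' Ss' vs'] := Sv _ d0.
exists (s + t%:C%C *: s'); first by case: hS => _; exact.
have -> : u + t%:C%C *: v - (s + t%:C%C *: s') = (u - s) + t%:C%C *: (v - s').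
  by rewrite scalerBr opprD addrACA.
apply: le_lt_trans (normD_le hr _ _) _; rewrite (normZ hr).
set d := e / _ in us vs' d0.
have -> : e = 2 * d + 2 * (1 + t ^+ 2) * d.
  by rewrite /d; field; rewrite gt_eqF //; have := sqr_ge0 t; lra.
apply: ltr_leD; first lra.
rewrite -mulrA ler_pM2l // mulrDl mul1r.
by have := ler_wpM2l (sqr_ge0 t) (ltW vs'); lra.
Qed.

Lemma dot_closure_orth S v w : (forall s, S s -> r s w = 0) ->
  dot_closure r S v -> r v w = 0.
Proof.
move=> Sw Sv; apply/eqP; rewrite -sqrf_eq0 eq_le sqr_ge0 andbT.
apply: (@le0_mulP _ _ (N w)); first exact: dot_ge0.
move=> e e0; have [s Ss vs] := Sv _ e0.
have -> : r v w = r (v - s) w by rewrite (dotDl hr) (dotNl hr) (Sw s) // subr0.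
by apply: le_trans (cauchy_schwarz hr _ _) _; rewrite ler_wpM2r ?(dot_ge0 hr) // ltW.
Qed.

End closure.

Lemma dot_closure_map (R : realType) (V W : lmodType R[i]) (r : V -> V -> R)
    (r' : W -> W -> R) (f : V -> W) (S : set V) (T : set W) :
  (forall u v, r' (f u - f v) (f u - f v) <= r (u - v) (u - v)) ->
  (forall s, S s -> T (f s)) -> forall v, dot_closure r S v -> dot_closure r' T (f v).
Proof.
move=> hf ST v Sv e /Sv[s Ss vs]; exists (f s); first exact: ST.
exact: le_lt_trans (hf _ _) vs.
Qed.

(** * Products of Hilbert spaces and closed isometric relations *)

Definition prod_dot (R : realType) (X Y : lmodType R[i]) (rX : X -> X -> R)
    (rY : Y -> Y -> R) (p q : X * Y) : R := rX p.1 q.1 + rY p.2 q.2.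

Section isometric_relation.
Variables (R : realType) (X Y : lmodType R[i]) (rX : X -> X -> R) (rY : Y -> Y -> R).
Hypotheses (hX : hilbert rX) (hY : hilbert rY).
Local Notation rXY := (prod_dot rX rY).

Lemma prod_hilbert : hilbert rXY.
Proof.
split; rewrite /prod_dot.
- by move=> u v; rewrite (dotC hX) (dotC hY).
- by move=> u v w /=; rewrite (dotDl hX) (dotDl hY); ring.
- by move=> t u v /=; rewrite (dotZl hX) (dotZl hY); ring.
- by move=> u v /=; rewrite (dotii hX) (dotii hY).
- by move=> u; rewrite addr_ge0 ?(dot_ge0 hX) ?(dot_ge0 hY).
move=> s hs.
have [|l hl] := dot_complete hX (s := fun n => (s n).1).
  move=> e /hs[N hN]; exists N => m n Nm Nn; apply: le_lt_trans (hN _ _ Nm Nn).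
  by rewrite lerDl (dot_ge0 hY).
have [|l' hl'] := dot_complete hY (s := fun n => (s n).2).
  move=> e /hs[N hN]; exists N => m n Nm Nn; apply: le_lt_trans (hN _ _ Nm Nn).
  by rewrite lerDr (dot_ge0 hX).
exists (l, l') => e e0; have e2 : 0 < e / 2 by lra.
have [n1 h1] := hl _ e2; have [n2 h2] := hl' _ e2.
exists (maxn n1 n2) => n; rewrite geq_max => /andP[/h1 + /h2] /=; lra.
Qed.

(** The equation is orthogonality to [(x, - y)] in the product space, which passes to the
    closure. *)
Lemma dot_closure_pair_eq (S : set (X * Y)) x y p :
  (forall s, S s -> rX s.1 x = rY s.2 y) -> dot_closure rXY S p ->
  rX p.1 x = rY p.2 y.
Proof.
move=> hS Sp; apply/eqP; rewrite -subr_eq0; apply/eqP.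
have := dot_closure_orth prod_hilbert (w := (x, - y)) _ Sp.
rewrite /prod_dot /= (dotNr hY); apply=> s /hS.
by rewrite (dotNr hY) => ->; rewrite subrr.
Qed.

(** Expand |d u - v|^2 >= 0 and divide by d. The factor 1 + d can be taken close to 1, unlike the 2
    of [normD_le], so norm bounds pass to limits without loss and without square roots. *)
Lemma normD_young (V : lmodType R[i]) (r : V -> V -> R) (hr : hilbert r) d u v :
  0 < d -> r (u + v) (u + v) <= (1 + d) * r u u + (1 + d^-1) * r v v.
Proof.
move=> d0; rewrite (normD hr); have := dot_ge0 hr (d%:C%C *: u - v).
rewrite (normD hr) (normZ hr) (normN hr) (dotNr hr) (dotZl hr) => h.
have : 0 <= d^-1 * (d ^+ 2 * r u u + 2 * - (d * r u v) + r v v).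
  by rewrite mulr_ge0 // invr_ge0 ltW.
have -> : d^-1 * (d ^+ 2 * r u u + 2 * - (d * r u v) + r v v) =
  d * r u u - 2 * r u v + d^-1 * r v v by field; rewrite gt_eqF.
lra.
Qed.

(** Two uses of [normD_young] compare [p.2] with [s.2] and [s.1] with [p.1], for s in S close to p.
    Letting the distance tend to 0 with d fixed leaves the factor (1 + d)^2; then d tends to 0. *)
Lemma dot_closure_contr (S : set (X * Y)) p :
  (forall s, S s -> rY s.2 s.2 <= rX s.1 s.1) -> dot_closure rXY S p ->
  rY p.2 p.2 <= rX p.1 p.1.
Proof.
move=> hS Sp; have x0 := dot_ge0 hX p.1.
(* The 3 comes from (1 + d)^2 <= 1 + 3 d for d <= 1. *)
apply: (@le_addmul _ _ _ (3 * rX p.1 p.1)) => [|d d0]; first lra.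
wlog d1 : d d0 / d <= 1 => [hw|].
  have [/hw|/ltW d1] := leP d 1; first exact.
  have := hw 1 ltr01 (lexx _); rewrite mul1r.
  have : 1 * (3 * rX p.1 p.1) <= d * (3 * rX p.1 p.1) by rewrite ler_wpM2r //; lra.
  lra.
have di0 : 0 < d^-1 by rewrite invr_gt0.
suff : rY p.2 p.2 <= (1 + d) ^+ 2 * rX p.1 p.1.
  have -> : (1 + d) ^+ 2 * rX p.1 p.1 =
    rX p.1 p.1 + d * (2 * rX p.1 p.1) + d * (d * rX p.1 p.1) by ring.
  have : d * (d * rX p.1 p.1) <= d * (1 * rX p.1 p.1).
    by rewrite ler_pM2l // ler_wpM2r.
  lra.
apply: (@le_addmul _ _ _ ((1 + d) * (1 + d^-1) + (1 + d^-1))) => [|e e0].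
  by apply: addr_ge0; [apply: mulr_ge0|]; lra.
have [s Ss ps] := Sp _ e0; have {hS}hs := hS _ Ss.
have px : rX (s.1 - p.1) (s.1 - p.1) <= e.
  rewrite (norm_distC hX); apply: le_trans (ltW ps).
  by rewrite lerDl (dot_ge0 hY).
have py : rY (p.2 - s.2) (p.2 - s.2) <= e.
  by apply: le_trans (ltW ps); rewrite lerDr (dot_ge0 hX).
have := normD_young hY s.2 (p.2 - s.2) d0; rewrite addrC subrK => h1.
have := normD_young hX p.1 (s.1 - p.1) d0; rewrite addrC subrK => h2.
apply: le_trans h1 _.
have h3 : (1 + d) * rY s.2 s.2 <=
    (1 + d) * ((1 + d) * rX p.1 p.1 + (1 + d^-1) * rX (s.1 - p.1) (s.1 - p.1)).
  by rewrite ler_pM2l; lra.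
have h4 : (1 + d^-1) * rY (p.2 - s.2) (p.2 - s.2) <= (1 + d^-1) * e.
  by rewrite ler_pM2l; lra.
have h5 : (1 + d) * (1 + d^-1) * rX (s.1 - p.1) (s.1 - p.1) <=
    (1 + d) * (1 + d^-1) * e.
  by rewrite ler_wpM2l // mulr_ge0; lra.
lra.
Qed.

(* A minimizing sequence for the distance from [f] to the domain of the
   relation is Cauchy by the parallelogram law, and isometry transports it. *)
Lemma isometric_relation_proj (S : set (X * Y)) (f : X) :
  real_subspace S -> (forall s, S s -> rY s.2 s.2 = rX s.1 s.1) ->
  exists p, dot_closure rXY S p /\ forall s, S s -> rX (f - p.1) s.1 = 0.
Proof.
move=> hS iso; pose D := [set rX (f - s.1) (f - s.1) | s in S].
have D0 : D !=set0 by exists (rX (f - 0) (f - 0)); exists 0 => //; case: hS.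
have Dl : has_lbound D by exists 0 => _ [s _ <-]; exact: dot_ge0.
have Di : has_inf D by [].
have d_le s : S s -> inf D <= rX (f - s.1) (f - s.1).
  by move=> Ss; apply: ge_inf => //; exists s.
have d_ad n : exists s, S s /\ rX (f - s.1) (f - s.1) < inf D + n.+1%:R^-1.
  have [|_ [s Ss <-] h] := @inf_adherent _ D n.+1%:R^-1 _ Di; last by exists s.
  by rewrite invr_gt0 ltr0n.
have [s hs] := choice d_ad; have Ss n := (hs n).1; have fs n := (hs n).2.
have sX m n : rX (s m - s n).1 (s m - s n).1 <= 2 * m.+1%:R^-1 + 2 * n.+1%:R^-1.
  have /d_le : S (2^-1%:C%C *: (s m + s n)).
    by apply: real_subspaceZ => //; exact: real_subspaceD.
  have -> : f - (2^-1%:C%C *: (s m + s n)).1 =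
     2^-1%:C%C *: ((f - (s m).1) + (f - (s n).1)).
    have -> : f - (s m).1 + (f - (s n).1) = (2%:C%C *: f) - (s m + s n).1.
      have -> : 2%:C%C = 1 + 1 :> R[i] by rewrite -[2]/(1 + 1) rmorphD rmorph1.
      by rewrite scalerDl scale1r opprD addrACA.
    by rewrite scalerBr scalerA -rmorphM mulVf ?pnatr_eq0 // rmorph1 scale1r.
  rewrite (normZ hX).
  have := parallelogram hX (f - (s m).1) (f - (s n).1).
  have -> : f - (s m).1 - (f - (s n).1) = - (s m - s n).1.
    by rewrite !opprB addrC subrKA.
  rewrite (normN hX) expr2; have := fs m; have := fs n.
  move: m.+1%:R^-1 n.+1%:R^-1 => a b.
  have -> : 2^-1 * 2^-1 = 4^-1 :> R by field.
  move=> h1 h2 h3; rewrite mulrC ler_pdivlMr // => h4; lra.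
have sC e : 0 < e -> exists N, forall m n, (N <= m)%N -> (N <= n)%N ->
   rXY (s m - s n) (s m - s n) < e.
  move=> e0; have e9 : 0 < e / 9 by lra.
  have [N hN] : exists N, forall n, (N <= n)%N -> n.+1%:R^-1 < e / 9.
    exists (Num.truncn (e / 9)^-1) => n hn.
    rewrite invf_plt ?posrE // ?ltr0n //.
    by apply: lt_le_trans (truncnS_gt _) _; rewrite ler_nat ltnS.
  exists N => m n /hN + /hN; have := sX m n.
  rewrite /prod_dot iso; last exact: real_subspaceB.
  move: m.+1%:R^-1 n.+1%:R^-1 => a b; lra.
have [p hp] := dot_complete prod_hilbert sC; exists p; split=> [e e0|q Sq].
  have [N hN] := hp _ e0; exists (s N) => //.
  by rewrite (norm_distC prod_hilbert); exact: hN.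
apply/eqP; rewrite -sqrf_eq0 eq_le sqr_ge0 andbT.
have q0 := dot_ge0 hX q.1.
apply: (@le0_mulP _ _ (4 * rX q.1 q.1)) => [|e e0]; first lra.
have [N hN] := hp _ e0; pose n := maxn N (Num.truncn e^-1).
have {hN}hn : rX (s n - p).1 (s n - p).1 < e.
  by apply: le_lt_trans (hN n (leq_maxl _ _)); rewrite lerDl (dot_ge0 hY).
have en : n.+1%:R^-1 < e.
  rewrite invf_plt ?posrE // ?ltr0n //.
  by apply: lt_le_trans (truncnS_gt _) _; rewrite ler_nat ltnS leq_maxr.
(* Moving [s n] along q cannot bring the squared distance below [inf D], so a quadratic polynomial
   in t is nonnegative; its discriminant makes [f - (s n).1] almost orthogonal to [q.1]. *)
have h1 : rX (f - (s n).1) q.1 ^+ 2 <= e * rX q.1 q.1.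
  apply: (@le_trans _ _ ((rX (f - (s n).1) (f - (s n).1) - inf D) * rX q.1 q.1)).
    apply: discriminant_le => t.
    have /d_le : S (s n + (- t)%:C%C *: q) by case: hS => _; exact.
    have -> : f - (s n + (- t)%:C%C *: q).1 = (f - (s n).1) + t%:C%C *: q.1.
      by rewrite /= rmorphN scaleNr opprD opprK addrA.
    by rewrite (normD hX) (normZ hX) (dotZr hX); lra.
  by rewrite ler_wpM2r //; have := fs n; move: n.+1%:R^-1 en => a; lra.
have h2 : rX (s n - p).1 q.1 ^+ 2 <= e * rX q.1 q.1.
  by apply: le_trans (cauchy_schwarz hX _ _) _; rewrite ler_wpM2r // ltW.
have -> : f - p.1 = (f - (s n).1) + (s n - p).1 by rewrite addrA subrK.
rewrite (dotDl hX); set A := rX (f - _) _ in h1 *; set B := rX (s n - p).1 _ in h2 *.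
by have := sqr_ge0 (A - B); rewrite sqrrB sqrrD; lra.
Qed.

Lemma real_span_isometric (G : set (X * Y)) :
  (forall p q, G p -> G q -> rX p.1 q.1 = rY p.2 q.2) ->
  forall s, real_span G s -> rY s.2 s.2 = rX s.1 s.1.
Proof.
move=> hG; suff h p q : real_span G p -> real_span G q -> rX p.1 q.1 = rY p.2 q.2.
  by move=> s hs; rewrite h.
move=> hp; elim: hp q => [|t u v hu ih Gv] q hq; first by rewrite (dot0l hX) (dot0l hY).
rewrite /= (dotDl hX) (dotDl hY) (dotZl hX) (dotZl hY) ih //; congr (_ + _ * _).
elim: hq => [|t' u' v' _ ih' Gv']; first by rewrite (dot0r hX) (dot0r hY).
by rewrite /= (dotDr hX) (dotDr hY) (dotZr hX) (dotZr hY) ih' hG.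
Qed.

End isometric_relation.

(** * Square summable families *)

Definition sqmod (R : realType) (z : R[i]) : R :=
  complex.Re z ^+ 2 + complex.Im z ^+ 2.

Section sqmod_theory.
Variable R : realType.
Implicit Types z w : R[i].

Lemma sqmod_ge0 z : 0 <= sqmod z.
Proof. by rewrite addr_ge0 ?sqr_ge0. Qed.

Lemma sqmodM z w : sqmod (z * w) = sqmod z * sqmod w.
Proof. by case: z w => [a b] [c d]; rewrite /sqmod /=; ring. Qed.

Lemma sqmodD_le z w : sqmod (z + w) <= 2 * sqmod z + 2 * sqmod w.
Proof.
case: z w => [a b] [c d]; rewrite /sqmod /=.
by have := sqr_ge0 (a - c); have := sqr_ge0 (b - d); rewrite !sqrrB !sqrrD; lra.
Qed.

Lemma sqmodN z : sqmod (- z) = sqmod z.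
Proof. by case: z => [a b]; rewrite /sqmod /=; ring. Qed.

Lemma sqmod0 : sqmod (0 : R[i]) = 0.
Proof. by rewrite /sqmod /= expr0n addr0. Qed.

Lemma sqmod_eq0 z : sqmod z = 0 -> z = 0.
Proof.
case: z => a b /eqP; rewrite /sqmod /= paddr_eq0 ?sqr_ge0 // !sqrf_eq0.
by move=> /andP[/eqP -> /eqP ->].
Qed.

End sqmod_theory.

(* Meaningful only for nonnegative summable families. *)
Definition finsum (R : realType) (I : choiceType) (p : I -> R) : R :=
  fine (\esum_(i in setT) (p i)%:E).

Definition nonneg_summable (R : realType) (I : choiceType) (p : I -> R) : Prop :=
  (forall i, 0 <= p i) /\ (\esum_(i in setT) (p i)%:E < +oo)%E.

Section finsum_theory.
Variables (R : realType) (I : choiceType).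
Implicit Types p q : I -> R.

Lemma finsumE p : nonneg_summable p ->
  \esum_(i in setT) (p i)%:E = (finsum p)%:E.
Proof.
move=> [p0 ps]; rewrite fineK // ge0_fin_numE // esum_ge0 // => i _.
by rewrite lee_fin.
Qed.

Lemma finsum_ge0 p : (forall i, 0 <= p i) -> 0 <= finsum p.
Proof. by move=> p0; apply: fine_ge0; apply: esum_ge0 => i _; rewrite lee_fin. Qed.

Lemma nonneg_summable_le p q : (forall i, 0 <= p i <= q i) ->
  nonneg_summable q -> nonneg_summable p.
Proof.
move=> h [q0 qs]; split=> [i|]; first by case/andP: (h i).
apply: le_lt_trans qs; apply: le_esum => i _; rewrite lee_fin.
by case/andP: (h i).
Qed.

Lemma finsumD_subproof p q : nonneg_summable p -> nonneg_summable q ->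
  \esum_(i in setT) (p i + q i)%:E = (finsum p + finsum q)%:E.
Proof.
move=> hp hq; rewrite EFinD -!finsumE // -esumD //.
- by move=> i _; rewrite lee_fin; case: hp => + _; exact.
- by move=> i _; rewrite lee_fin; case: hq => + _; exact.
Qed.

Lemma nonneg_summableD p q : nonneg_summable p -> nonneg_summable q ->
  nonneg_summable (fun i => p i + q i).
Proof.
move=> hp hq; split=> [i|]; last by rewrite finsumD_subproof // ltry.
by case: hp hq => + _ [+ _] => /(_ i) ? /(_ i) ?; exact: addr_ge0.
Qed.

Lemma finsumD p q : nonneg_summable p -> nonneg_summable q ->
  finsum (fun i => p i + q i) = finsum p + finsum q.
Proof. by move=> hp hq; rewrite {1}/finsum finsumD_subproof. Qed.

Lemma nonneg_summableP p : (forall i, 0 <= p i) ->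
  (exists M : R, forall A : seq I, uniq A -> \sum_(i <- A) p i <= M) ->
  nonneg_summable p.
Proof.
move=> p0 [M hM]; split => //; apply: (@le_lt_trans _ _ M%:E); last exact: ltry.
apply: ge_ereal_sup => _ [A [finA _] <-]; rewrite fsbig_finite //= sumEFin lee_fin.
exact: hM.
Qed.

Lemma finsum_le p M : (forall i, 0 <= p i) ->
  (forall A : seq I, uniq A -> \sum_(i <- A) p i <= M) -> finsum p <= M.
Proof.
move=> p0 hM; rewrite -lee_fin -finsumE; last by apply: nonneg_summableP => //; exists M.
apply: ge_ereal_sup => _ [A [finA _] <-]; rewrite fsbig_finite //= sumEFin lee_fin.
exact: hM.
Qed.

Lemma finsum_ge p (A : seq I) : nonneg_summable p -> uniq A ->
  \sum_(i <- A) p i <= finsum p.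
Proof.
move=> hp uA; rewrite -lee_fin -finsumE //.
apply: esum_ge; exists [set` A]; first by split=> //; exact: finite_seq.
rewrite fsbig_finite ?finite_seq //= sumEFin lee_fin.
rewrite [leRHS](perm_big A) //=.
apply: uniq_perm => // i; rewrite in_fset_set ?finite_seq //.
by apply/idP/idP => [/set_mem|] //; exact: mem_set.
Qed.

Lemma finsumZ_le (t : R) p : 0 <= t -> nonneg_summable p ->
  nonneg_summable (fun i => t * p i) /\ finsum (fun i => t * p i) <= t * finsum p.
Proof.
move=> t0 hp.
have tp i : 0 <= t * p i by rewrite mulr_ge0 //; case: hp.
have h (A : seq I) : uniq A -> \sum_(i <- A) t * p i <= t * finsum p.
  by move=> uA; rewrite -mulr_sumr ler_wpM2l //; exact: finsum_ge.
by split; [apply: nonneg_summableP => //; exists (t * finsum p) | exact: finsum_le].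
Qed.

Lemma nonneg_summableZ (t : R) p : 0 <= t -> nonneg_summable p ->
  nonneg_summable (fun i => t * p i).
Proof. by move=> t0 hp; have [] := finsumZ_le t0 hp. Qed.

Lemma finsum0 : finsum (fun _ : I => 0 : R) = 0.
Proof. by rewrite /finsum esum1. Qed.

(** [finsumZ_le] for t gives one inequality, and for t^-1 the other. *)
Lemma finsumZ (t : R) p : 0 <= t -> nonneg_summable p ->
  finsum (fun i => t * p i) = t * finsum p.
Proof.
move=> t0 hp; apply: le_anti; have [hs -> /=] := finsumZ_le t0 hp.
have [->|tn0] := eqVneq t 0.
  by rewrite mul0r; under eq_fun do rewrite mul0r; rewrite finsum0.
have ti : 0 <= t^-1 by rewrite invr_ge0.
have [_] := finsumZ_le ti hs.
under eq_fun do rewrite mulKf //.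
by rewrite ler_pdivlMl // lt_def tn0.
Qed.

End finsum_theory.

(** Extension by 0 along an injection with partial inverse [psi]; this is what makes the shifts
    isometric. *)
Lemma finsum_inj (R : realType) (I J : choiceType) (phi : I -> J)
    (psi : J -> option I) (p : I -> R) :
  pcancel phi psi -> ocancel psi phi -> nonneg_summable p ->
  let q j := if psi j is Some i then p i else 0 in
  nonneg_summable q /\ finsum q = finsum p.
Proof.
move=> phiK psiK hp q.
have E : \esum_(j in setT) (q j)%:E = \esum_(i in setT) (p i)%:E.
  have -> : \esum_(i in setT) (p i)%:E = \esum_(j in range phi) (q j)%:E.
    rewrite (reindex_esum setT (range phi) phi).
      by apply: eq_esum => i _; rewrite /q phiK.
    split=> [i _|i j _ _ /(congr1 psi)|j [i _ <-]]; first by exists i.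
      by rewrite !phiK => -[].
    by exists i.
  rewrite [RHS]esum_mkcond; apply: eq_esum => j _.
  case: ifPn => // /negP; rewrite inE => hj; rewrite /q.
  case: (psi j) (psiK j) => //= i ij; exfalso; apply: hj; by exists i.
rewrite /nonneg_summable /finsum E; split=> //; split; last by case: hp.
by move=> j; rewrite /q; case: (psi j) => // i; case: hp.
Qed.

Definition l2_mem (R : realType) (I : choiceType) : {pred I -> R[i]^o} :=
  [pred f | `[< nonneg_summable (fun i => sqmod (f i)) >]].

Record l2 (R : realType) (I : choiceType) := L2 {
  l2_fun :> I -> R[i]^o;
  _ : l2_fun \in @l2_mem R I }.

Section l2_module.
Variables (R : realType) (I : choiceType).

Lemma l2_submod_closed : submod_closed (@l2_mem R I).
Proof.
split=> [|c f g /asboolP hf /asboolP hg]; apply/asboolP.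
  apply: nonneg_summableP => [i|]; first exact: sqmod_ge0.
  by exists 0 => A _; rewrite big1 // => i _; rewrite sqmod0.
apply: (@nonneg_summable_le _ _ _
  (fun i => 2 * sqmod c * sqmod (f i) + 2 * sqmod (g i))) => [i|].
  rewrite sqmod_ge0 /=; apply: le_trans (sqmodD_le _ _) _.
  by rewrite sqmodM mulrA.
by apply: nonneg_summableD; apply: nonneg_summableZ; rewrite ?mulr_ge0 ?sqmod_ge0.
Qed.

HB.instance Definition _ := [isSub for @l2_fun R I].
HB.instance Definition _ := [Choice of l2 R I by <:].
HB.instance Definition _ := GRing.isSubmodClosed.Build _ _ (@l2_mem R I)
  l2_submod_closed.
HB.instance Definition _ := [SubChoice_isSubLmodule of l2 R I by <:].

Implicit Types f g h : l2 R I.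

Lemma l2P f : nonneg_summable (fun i => sqmod (f i)).
Proof. exact/asboolP/(valP f). Qed.

Lemma l2_eqP f g : f =1 g -> f = g.
Proof. by move=> fg; exact/val_inj/funext. Qed.

Lemma l2D f g i : (f + g) i = f i + g i. Proof. by []. Qed.
Lemma l2N f i : (- f) i = - f i. Proof. by []. Qed.
Lemma l2Z (c : R[i]) f i : (c *: f) i = c * f i. Proof. by []. Qed.

End l2_module.

(* The real part of the inner product, by polarization: it only needs sums of
   nonnegative families. *)
Definition l2_dot (R : realType) (I : choiceType) (f g : l2 R I) : R :=
  (finsum (fun i => sqmod (f i + g i)) - finsum (fun i => sqmod (f i - g i))) / 4.

Section l2_hilbert.
Variables (R : realType) (I : choiceType).
Implicit Types f g h : l2 R I.

Let summD f g : nonneg_summable (fun i => sqmod (f i + g i)).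
Proof. exact: l2P (f + g). Qed.

Let summB f g : nonneg_summable (fun i => sqmod (f i - g i)).
Proof. exact: l2P (f - g). Qed.

(** Moving the subtracted sums of the polarization formula to the other side leaves sums of
    nonnegative families, which [finsumD] merges so that they can be compared term by term. *)
Lemma l2_dot_termwise f g f' g' :
  (forall i, complex.Re (f i * conjc (g i)) = complex.Re (f' i * conjc (g' i))) ->
  l2_dot f g = l2_dot f' g'.
Proof.
move=> h; rewrite /l2_dot; congr (_ / _).
apply/eqP; rewrite subr_eq addrAC eq_sym subr_eq; apply/eqP.
rewrite -!finsumD //; congr finsum; apply/funext => i; move: (h i).
case: (f i) (g i) (f' i) (g' i) => [a b] [c d] [a' b'] [c' d'].
by rewrite /sqmod /=; lra.
Qed.

Lemma l2_normE f : l2_dot f f = finsum (fun i => sqmod (f i)).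
Proof.
rewrite /l2_dot; under [X in _ - finsum X]eq_fun do rewrite subrr sqmod0.
rewrite finsum0 subr0.
have -> : (fun i => sqmod (f i + f i)) = (fun i => 4 * sqmod (f i)).
  by apply/funext => i; case: (f i) => a b; rewrite /sqmod /=; ring.
rewrite (finsumZ _ (l2P f)) //; lra.
Qed.

Lemma l2_coord_le f i : sqmod (f i) <= l2_dot f f.
Proof.
by have := finsum_ge (l2P f) (A := [:: i]) isT; rewrite l2_normE big_seq1.
Qed.

Lemma l2_dotC f g : l2_dot f g = l2_dot g f.
Proof.
apply: l2_dot_termwise => i; case: (f i) (g i) => [a b] [c d] /=; ring.
Qed.

Lemma l2_dotNl f g : l2_dot (- f) g = - l2_dot f g.
Proof.
rewrite /l2_dot -mulNr opprB; congr ((_ - _) / _); congr finsum; apply/funext => i;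
by rewrite l2N -[RHS]sqmodN ?opprB ?opprD ?opprK addrC.
Qed.

Lemma l2_dotDl f g h : l2_dot (f + g) h = l2_dot f h + l2_dot g h.
Proof.
have summ3 := nonneg_summableD (summD (f + g) h)
  (nonneg_summableD (summB f h) (summB g h)).
(* Clearing the subtractions of the polarization formula leaves sums of squared moduli that agree at
   each index. *)
suff : finsum (fun i => sqmod ((f + g) i + h i)) +
    (finsum (fun i => sqmod (f i - h i)) + finsum (fun i => sqmod (g i - h i))) =
  finsum (fun i => sqmod ((f + g) i - h i)) +
    (finsum (fun i => sqmod (f i + h i)) + finsum (fun i => sqmod (g i + h i))).
  by rewrite /l2_dot; lra.
rewrite -!finsumD //; try exact: nonneg_summableD.
congr finsum; apply/funext => i; rewrite !l2D.
by case: (f i) (g i) (h i) => [a b] [c d] [e j]; rewrite /sqmod /=; ring.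
Qed.

Lemma l2_dotZl (t : R) f g : l2_dot (t%:C%C *: f) g = t * l2_dot f g.
Proof.
wlog t0 : t / 0 <= t => [hw|].
  have [/hw //|/ltW t0] := leP 0 t.
  rewrite -[t]opprK rmorphN scaleNr l2_dotNl hw ?mulNr //; lra.
suff : finsum (fun i => sqmod ((t%:C%C *: f) i + g i)) +
    t * finsum (fun i => sqmod (f i - g i)) =
  finsum (fun i => sqmod ((t%:C%C *: f) i - g i)) +
    t * finsum (fun i => sqmod (f i + g i)).
  by rewrite /l2_dot; lra.
rewrite -!finsumZ // -!finsumD //; try exact: nonneg_summableZ.
congr finsum; apply/funext => i; rewrite !l2Z.
by case: (f i) (g i) => [a b] [c d]; rewrite /sqmod /=; ring.
Qed.

Lemma real_cauchy_lim (x : nat -> R) :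
  (forall e, 0 < e -> exists N, forall m n, (N <= m)%N -> (N <= n)%N ->
     (x m - x n) ^+ 2 < e) ->
  exists l, forall e, 0 < e -> exists N, forall n, (N <= n)%N -> (x n - l) ^+ 2 < e.
Proof.
move=> hx.
have xc : cvgn x.
  apply: cauchy_cvg; apply: cauchy_exP => e e0.
  have [N hN] := hx (e ^+ 2) (exprn_gt0 _ e0); exists (x N).
  exists N => // n /= Nn; rewrite -ball_normE /=.
    have := hN _ _ (leqnn N) Nn.
  rewrite -[X in X < _](real_normK (num_real _)) ltr_pXn2r // nnegrE //; exact: ltW.
exists (limn x) => e e0.
have /cvgrPdist_lt/(_ (Num.sqrt e)) [|N _ hN] := xc; first by rewrite sqrtr_gt0.
exists N => n /hN /= h.
rewrite -[X in X < _](real_normK (num_real _)) distrC -[e]sqr_sqrtr ?ltW //.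
by rewrite ltr_pXn2r // nnegrE sqrtr_ge0.
Qed.

(** Coordinates converge to some l. On a finite index set A, [s n] is compared with l through some
    [s m]; here m depends on A but N does not, so the bound holds for the whole sum. *)
Lemma l2_complete (s : nat -> l2 R I) :
  (forall e, 0 < e -> exists N, forall m n, (N <= m)%N -> (N <= n)%N ->
     l2_dot (s m - s n) (s m - s n) < e) ->
  exists l, forall e, 0 < e -> exists N, forall n, (N <= n)%N ->
     l2_dot (s n - l) (s n - l) < e.
Proof.
move=> hs.
have lim_i i : exists z : R[i], forall e, 0 < e -> exists N, forall n, (N <= n)%N ->
    sqmod (s n i - z) < e.
  have [|a ha] := real_cauchy_lim (x := fun n => complex.Re (s n i)).
    move=> e /hs[N hN]; exists N => m n Nm Nn; apply: le_lt_trans (hN _ _ Nm Nn).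
    apply: le_trans (l2_coord_le _ i).
    rewrite l2D l2N; case: (s m i) (s n i) => [a b] [c d].
    by rewrite /sqmod /= lerDl sqr_ge0.
  have [|b hb] := real_cauchy_lim (x := fun n => complex.Im (s n i)).
    move=> e /hs[N hN]; exists N => m n Nm Nn; apply: le_lt_trans (hN _ _ Nm Nn).
    apply: le_trans (l2_coord_le _ i).
    rewrite l2D l2N; case: (s m i) (s n i) => [c b] [c' d].
    by rewrite /sqmod /= lerDr sqr_ge0.
  exists (a +i* b)%C => e e0; have e2 : 0 < e / 2 by lra.
  have [N1 h1] := ha _ e2; have [N2 h2] := hb _ e2.
  exists (maxn N1 N2) => n; rewrite geq_max => /andP[/h1 + /h2].
  by case: (s n i) => c d; rewrite /sqmod /=; lra.
have [l hl] := choice lim_i.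
have hA (A : seq I) e : 0 < e -> exists N, forall n, (N <= n)%N ->
    \sum_(i <- A) sqmod (s n i - l i) < e.
  elim: A e => [|i A ih] e e0; first by exists 0%N => n _; rewrite big_nil.
  have e2 : 0 < e / 2 by lra.
  have [N1 h1] := hl i _ e2; have [N2 h2] := ih _ e2.
  exists (maxn N1 N2) => n; rewrite geq_max big_cons => /andP[/h1 + /h2]; lra.
have hN e : 0 < e -> exists N, forall n, (N <= n)%N ->
    forall A : seq I, uniq A -> \sum_(i <- A) sqmod (s n i - l i) <= e.
  move=> e0; have e4 : 0 < e / 4 by lra.
  have [N hN] := hs _ e4; exists N => n Nn A uA.
  have [N' hN'] := hA A _ e4; pose m := maxn N N'.
  have h1 : \sum_(i <- A) sqmod (s n i - s m i) < e / 4.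
    apply: le_lt_trans (hN n m Nn (leq_maxl _ _)); rewrite l2_normE.
    exact: finsum_ge (l2P (s n - s m)) uA.
  have h2 := hN' m (leq_maxr _ _).
  apply: (@le_trans _ _ (\sum_(i <- A)
    (2 * sqmod (s n i - s m i) + 2 * sqmod (s m i - l i)))).
    by apply: ler_sum => i _; rewrite -[s n i - l i](subrKA (s m i)); exact: sqmodD_le.
  by rewrite big_split /= -!mulr_sumr; lra.
have [N0 h0] := hN _ ltr01.
have lP : l \in @l2_mem R I.
  apply/asboolP; have hd : nonneg_summable (fun i => sqmod (s N0 i - l i)).
    apply: nonneg_summableP => [i|]; first exact: sqmod_ge0.
    by exists 1; exact: h0.
  apply: (@nonneg_summable_le _ _ _
    (fun i => 2 * sqmod (s N0 i - l i) + 2 * sqmod (s N0 i))) => [i|].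
    rewrite sqmod_ge0 /= -[sqmod (s N0 i - _)]sqmodN opprB.
    by apply: le_trans (sqmodD_le _ _); rewrite subrK.
  by apply: nonneg_summableD; apply: nonneg_summableZ => //; exact: l2P.
exists (L2 lP) => e e0; have e2 : 0 < e / 2 by lra.
have [N hN'] := hN _ e2; exists N => n Nn.
apply: (@le_lt_trans _ _ (e / 2)); last by lra.
rewrite l2_normE; apply: finsum_le => [i|]; [exact: sqmod_ge0|exact: hN'].
Qed.

Lemma l2_hilbert : hilbert (@l2_dot R I).
Proof.
split; [exact: l2_dotC|exact: l2_dotDl|exact: l2_dotZl| | |exact: l2_complete].
  move=> f g; apply: l2_dot_termwise => i; rewrite !l2Z.
  by case: (f i) (g i) => [a b] [c d] /=; ring.
by move=> f; rewrite l2_normE; apply: finsum_ge0 => i; exact: sqmod_ge0.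
Qed.

End l2_hilbert.

(** For a form linear in u and antilinear in v, Im <u, v> = Re <u, i v>; so the real part r
    determines the complex inner product. *)
Definition cdot (R : realType) (V : lmodType R[i]) (r : V -> V -> R) (u v : V) : R[i] :=
  (r u v +i* r u ('i%C *: v))%C.

Definition family_span (R : realType) (V : lmodType R[i]) (J : Type) (x : J -> V) : set V :=
  real_span [set c *: x j | c in [set: R[i]] & j in [set: J]].

Section cdot_theory.
Variables (R : realType) (V : lmodType R[i]) (r : V -> V -> R).
Hypothesis hr : hilbert r.
Implicit Types (u v w : V) (c d : R[i]).
Local Notation cd := (cdot r).

Lemma cdotDl u v w : cd (u + v) w = cd u w + cd v w.
Proof. by rewrite /cdot !(dotDl hr). Qed.

Lemma cdotZl c u v : cd (c *: u) v = c * cd u v.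
Proof.
rewrite (scale_complexE c) /cdot !(dotDl hr) !(dotZl hr) (dotii hr) (dotil hr).
by case: c => a b; congr (_ +i* _)%C => /=; ring.
Qed.

Lemma cdotNl u v : cd (- u) v = - cd u v.
Proof. by rewrite -scaleN1r cdotZl mulN1r. Qed.

Lemma cdotBl u v w : cd (u - v) w = cd u w - cd v w.
Proof. by rewrite cdotDl cdotNl. Qed.

Lemma cdotC u v : cd v u = conjc (cd u v).
Proof.
rewrite /cdot /= (dotC hr v u); congr (_ +i* _)%C.
by rewrite (dotC hr) (dotil hr).
Qed.

Lemma cdotDr u v w : cd u (v + w) = cd u v + cd u w.
Proof. by rewrite [LHS]cdotC cdotDl rmorphD [cd u v]cdotC [cd u w]cdotC. Qed.

Lemma cdotZr c u v : cd u (c *: v) = conjc c * cd u v.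
Proof. by rewrite [LHS]cdotC cdotZl rmorphM [cd u v]cdotC. Qed.

Lemma cdotBr u v w : cd u (v - w) = cd u v - cd u w.
Proof. by rewrite [LHS]cdotC cdotBl rmorphB [cd u v]cdotC [cd u w]cdotC. Qed.

Lemma cdot0l u : cd 0 u = 0.
Proof. by rewrite /cdot !(dot0l hr). Qed.

Lemma cdot0r u : cd u 0 = 0.
Proof. by rewrite cdotC cdot0l rmorph0. Qed.

Lemma cdot_sumr (I : Type) (s : seq I) (P : pred I) (x : I -> V) u :
  cd u (\sum_(i <- s | P i) x i) = \sum_(i <- s | P i) cd u (x i).
Proof. by elim/big_rec2: _ => [|i a b _ <-]; rewrite ?cdot0r ?cdotDr. Qed.

Lemma cdotvv u : cd u u = (r u u)%:C%C.
Proof. by rewrite /cdot (dot_i hr). Qed.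

Lemma cdot_Re u v : r u v = complex.Re (cd u v).
Proof. by []. Qed.

Lemma cdot_eq0P u v : cd u v = 0 <-> r u v = 0 /\ r u ('i%C *: v) = 0.
Proof. by rewrite /cdot; split=> [[-> ->]|[-> ->]]. Qed.

Lemma dotZZ c d u v : r (c *: u) (d *: v) = complex.Re (c * conjc d * cd u v).
Proof. by rewrite cdot_Re cdotZl cdotZr mulrA. Qed.

Lemma sqnormZ c u : r (c *: u) (c *: u) = sqmod c * r u u.
Proof. by rewrite dotZZ cdotvv; case: c => a b; rewrite /sqmod /=; ring. Qed.

(** The 2 comes from using Cauchy-Schwarz once for the real and once for the imaginary part; it is
    harmless in limits. *)
Lemma sqmod_cdot_le u v : sqmod (cd u v) <= 2 * (r u u * r v v).
Proof.
rewrite /sqmod /=; have := cauchy_schwarz hr u v.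
by have := cauchy_schwarz hr u ('i%C *: v); rewrite (dotii hr); lra.
Qed.

Lemma pythagoras u v : cd u v = 0 -> r (u + v) (u + v) = r u u + r v v.
Proof. by move=> [uv _]; rewrite (normD hr) uv; ring. Qed.

Section family.
Variables (J : Type) (x : J -> V).

Lemma mem_family_span c j : family_span x (c *: x j).
Proof. by apply: mem_real_span; exists c => //; exists j. Qed.

Lemma family_mem j : family_span x (x j).
Proof. by rewrite -[x j]scale1r; exact: mem_family_span. Qed.

Lemma family_span_real_subspace : real_subspace (family_span x).
Proof. exact: real_span_subspace. Qed.

Lemma family_span_min (S : set V) : real_subspace S ->
  (forall c j, S (c *: x j)) -> forall u, family_span x u -> S u.
Proof.
by move=> hS xS u; apply: real_span_min => // _ [c _ [j _ <-]]; exact: xS.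
Qed.

Lemma family_spanZ c u : family_span x u -> family_span x (c *: u).
Proof.
move: u; apply: (family_span_min (S := [set u | family_span x (c *: u)])) => [|d j]; last first.
  by rewrite /= scalerA; exact: mem_family_span.
split=> [|t u v hu hv] /=; first by rewrite scaler0; exact: real_span0.
have -> : c *: (u + t%:C%C *: v) = c *: u + t%:C%C *: (c *: v).
  by rewrite scalerDr !scalerA mulrC.
have hS := family_span_real_subspace.
by apply: (real_subspaceD hS) => //; exact (real_subspaceZ t hS hv).
Qed.

Lemma closed_spanZ c u : dot_closure r (family_span x) u ->
  dot_closure r (family_span x) (c *: u).
Proof.
move=> hu; rewrite scale_complexE.
have hS := dot_closure_subspace hr family_span_real_subspace.
apply: (real_subspaceD hS); apply: (real_subspaceZ _ hS) => //.
move: u hu; apply: dot_closure_map => [u v|s]; last exact: family_spanZ.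
by rewrite -scalerBr (dotii hr).
Qed.

Lemma family_span_orth v u : (forall j, cd (x j) v = 0) ->
  dot_closure r (family_span x) u -> cd u v = 0.
Proof.
move=> xv xu.
have h w : (forall j, cd (x j) w = 0) -> r u w = 0.
  move=> xw; apply: dot_closure_orth xu => // s; move: s.
  apply: (family_span_min (S := [set s | r s w = 0])) => [|c j];
    last by rewrite /= cdot_Re cdotZl xw mulr0.
  split=> [|t a b ha hb]; first exact: dot0l.
  by rewrite /= (dotDl hr) (dotZl hr) ha hb mulr0 addr0.
apply/cdot_eq0P; split; apply: h => // j.
by rewrite cdotZr xv mulr0.
Qed.

End family.

End cdot_theory.

(** * Partial isometries prescribed on generators *)

Section transfer.
Variables (R : realType) (X Y : lmodType R[i]) (rX : X -> X -> R) (rY : Y -> Y -> R).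
Hypotheses (hX : hilbert rX) (hY : hilbert rY).
Variables (J : Type) (x : J -> X) (y : J -> Y).
Local Notation rXY := (prod_dot rX rY).
Local Notation graph := (dot_closure rXY (family_span (fun j => (x j, y j)))).

(** How images are computed: to evaluate [p.2] against v, it is enough to find u with the same
    products against the generators. The adjoint is thus used without being defined. *)
Lemma graph_cdot_eq p u v : (forall j, cdot rX (x j) u = cdot rY (y j) v) ->
  graph p -> cdot rX p.1 u = cdot rY p.2 v.
Proof.
move=> huv hp.
have h u' v' : (forall j, cdot rX (x j) u' = cdot rY (y j) v') ->
    rX p.1 u' = rY p.2 v'.
  move=> huv'; apply: (dot_closure_pair_eq hX hY) hp => s; move: s.
  apply: (family_span_min (S := [set s | rX s.1 u' = rY s.2 v'])) => [|c j].
    split=> [|t a b ha hb] /=; first by rewrite (dot0l hX) (dot0l hY).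
    by rewrite (dotDl hX) (dotDl hY) (dotZl hX) (dotZl hY) ha hb.
  by rewrite /= !cdot_Re (cdotZl hX) (cdotZl hY) huv'.
congr (_ +i* _)%C; apply: h => // j.
by rewrite (cdotZr hX) (cdotZr hY) huv.
Qed.

Lemma graph_fst p : graph p -> dot_closure rX (family_span x) p.1.
Proof.
move: p; apply: dot_closure_map => [p q|s]; first by rewrite lerDl (dot_ge0 hY).
move: s; apply: (family_span_min (S := [set s | family_span x s.1])) => [|c j];
  last exact: mem_family_span.
split=> [|t u v hu hv] /=; first exact: real_span0.
have hS := family_span_real_subspace x.
by apply: (real_subspaceD hS) => //; apply: (real_subspaceZ _ hS).
Qed.

(** [p.1] is the orthogonal projection of f on the closed span of the [x j], and [p.2] its image
    under the isometry sending [x j] to [y j]. *)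
Lemma graph_proj f : (forall i j, cdot rX (x i) (x j) = cdot rY (y i) (y j)) ->
  exists p, [/\ graph p, forall j, cdot rX (f - p.1) (x j) = 0,
    rX p.1 p.1 <= rX f f & rY p.2 p.2 <= rX p.1 p.1].
Proof.
move=> gram.
have iso : forall s, family_span (fun j => (x j, y j)) s -> rY s.2 s.2 = rX s.1 s.1.
  apply: (real_span_isometric hX hY) => _ _ [c _ [j _ <-]] [d _ [j' _ <-]] /=.
  by rewrite (dotZZ hX) (dotZZ hY) gram.
have [p [hp orth]] :=
  isometric_relation_proj hX hY f (family_span_real_subspace _) iso.
have po j : cdot rX (f - p.1) (x j) = 0.
  apply/cdot_eq0P; split.
    exact: (orth (x j, y j) (family_mem _ j)).
  exact: (orth ('i%C *: x j, 'i%C *: y j) (mem_family_span _ 'i%C j)).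
exists p; split => //.
  have o : cdot rX p.1 (f - p.1) = 0.
    apply: family_span_orth (graph_fst hp) => // j.
    by rewrite (cdotC hX) po rmorph0.
  have := pythagoras hX o; rewrite subrKC => ->.
  by rewrite lerDl (dot_ge0 hX).
by apply: dot_closure_contr hp => // s /iso ->.
Qed.

Lemma graph_snd p : graph p -> dot_closure rY (family_span y) p.2.
Proof.
move: p; apply: dot_closure_map => [p q|s]; first by rewrite lerDr (dot_ge0 hX).
move: s; apply: (family_span_min (S := [set s | family_span y s.2])) => [|c j];
  last exact: mem_family_span.
split=> [|t u v hu hv] /=; first exact: real_span0.
have hS := family_span_real_subspace y.
by apply: (real_subspaceD hS) => //; exact: (real_subspaceZ _ hS).
Qed.

Lemma transfer f : (forall i j, cdot rX (x i) (x j) = cdot rY (y i) (y j)) ->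
  exists g, [/\ dot_closure rY (family_span y) g, rY g g <= rX f f &
    forall j, cdot rY g (y j) = cdot rX f (x j)].
Proof.
move=> gram; have [p [hp orth n1 n2]] := graph_proj f gram.
exists p.2; split; [exact: graph_snd|exact: le_trans n2 n1|move=> j].
rewrite -(graph_cdot_eq _ hp (u := x j)) => [|i]; last exact: gram.
by apply/eqP; rewrite eq_sym -subr_eq0 -(cdotBl hX) orth.
Qed.

End transfer.

(** Projection on a closed span is the case of the identity relation, y = x. *)
Lemma hilbert_proj (R : realType) (V : lmodType R[i]) (r : V -> V -> R)
    (hr : hilbert r) (J : Type) (x : J -> V) f :
  exists p, dot_closure r (family_span x) p /\ forall j, cdot r (f - p) (x j) = 0.
Proof.
have [p [hp orth _ _]] := graph_proj hr hr f (fun i j => erefl (cdot r (x i) (x j))).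
by exists p.1; split=> //; exact: graph_fst hp.
Qed.

(** * The standard basis *)

Section delta.
Variables (R : realType) (I : choiceType).
Local Notation ldot := (@l2_dot R I).
Implicit Types f g : l2 R I.

Let deltaf (i : I) : I -> R[i]^o := fun j => (j == i)%:R.

Lemma l2_delta_sum i (A : seq I) : uniq A ->
  \sum_(j <- A) sqmod (deltaf i j) <= 1.
Proof.
have sq j : sqmod (deltaf i j) = (j == i)%:R.
  by rewrite /deltaf; case: (j == i); rewrite /sqmod /=; ring.
elim: A => [|a A ih] /=; first by rewrite big_nil.
rewrite big_cons sq => /andP[aA /ih h].
have [ai|_] := eqVneq a i; last by rewrite add0r.
rewrite big1_seq ?addr0 // => j /andP[_ jA]; rewrite sq.
by case: eqVneq => // ji; move: aA; rewrite ai -ji jA.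
Qed.

Lemma l2_delta_mem i : deltaf i \in @l2_mem R I.
Proof.
apply/asboolP; apply: nonneg_summableP => [j|]; first exact: sqmod_ge0.
by exists 1; exact: l2_delta_sum.
Qed.

Definition l2_delta i : l2 R I := L2 (l2_delta_mem i).

Lemma l2_deltaE i j : l2_delta i j = (j == i)%:R. Proof. by []. Qed.

Lemma l2_delta_norm i : ldot (l2_delta i) (l2_delta i) = 1.
Proof.
apply: le_anti; apply/andP; split.
  rewrite l2_normE; apply: finsum_le => [j|]; [exact: sqmod_ge0|exact: l2_delta_sum].
apply: le_trans (l2_coord_le _ i); rewrite l2_deltaE eqxx /sqmod /=.
by rewrite expr1n expr0n addr0.
Qed.

Lemma cdot_delta f i : cdot ldot f (l2_delta i) = f i.
Proof.
(* Only coordinate i contributes, so f may be replaced by its i-th term. *)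
have -> : cdot ldot f (l2_delta i) = cdot ldot (f i *: l2_delta i) (l2_delta i).
  congr (_ +i* _)%C; apply: l2_dot_termwise => j; rewrite ?l2Z l2_deltaE;
  by case: eqVneq => [->|_]; rewrite ?mulr1n ?mulr0n ?mulr1 ?mulr0 // rmorph0 !mulr0.
by rewrite (cdotZl (l2_hilbert _ _)) (cdotvv (l2_hilbert _ _)) l2_delta_norm mulr1.
Qed.

Lemma l2_cdot_eq0 f g : (forall i, f i * conjc (g i) = 0) -> cdot ldot f g = 0.
Proof.
move=> fg; have h g' : (forall i, f i * conjc (g' i) = 0) -> ldot f g' = 0.
  move=> fg'; rewrite -(dot0l (l2_hilbert R I) g').
  by apply: l2_dot_termwise => i; rewrite fg' mul0r.
apply/cdot_eq0P; split; apply: h => // i.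
by rewrite l2Z rmorphM mulrCA fg mulr0.
Qed.

Lemma l2_eq0 f : (forall i, f i = 0) -> f = 0.
Proof. by move=> h; apply: l2_eqP => i; rewrite h. Qed.

End delta.

(** * The Fock space and its shifts *)

(* The full Fock space with values in l^2(N): its basis is indexed by a
   component and a word in the noncommuting variables. *)
Notation fock_index := (nat * seq nat)%type.
Notation fock R := (l2 R fock_index).
Notation fdot := (@l2_dot _ fock_index).

Section shifts.
Variable R : realType.
Implicit Types (f g : fock R) (i : nat) (w : seq nat).
Let hF := l2_hilbert R fock_index.

Definition add_letter i (p : fock_index) : fock_index := (p.1, i :: p.2).

Definition drop_letter i (p : fock_index) : option fock_index :=
  if p.2 is j :: w then if j == i then Some (p.1, w) else None else None.

Lemma add_letterK i : pcancel (add_letter i) (drop_letter i).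
Proof. by case=> j w; rewrite /drop_letter /= eqxx. Qed.

Lemma drop_letterK i : ocancel (drop_letter i) (add_letter i).
Proof. by case=> j [|k w] //=; rewrite /drop_letter /=; case: eqVneq => [->|]. Qed.

Let shift_fun i f (p : fock_index) : R[i]^o :=
  if drop_letter i p is Some q then f q else 0.

Let sqmod_shift i f : (fun p => sqmod (shift_fun i f p)) =
  (fun p => if drop_letter i p is Some q then sqmod (f q) else 0).
Proof.
by apply/funext => p; rewrite /shift_fun; case: drop_letter => // ; rewrite sqmod0.
Qed.

Lemma shift_mem i f : shift_fun i f \in @l2_mem R fock_index.
Proof.
apply/asboolP; rewrite sqmod_shift.
by have [] := finsum_inj (@add_letterK i) (@drop_letterK i) (l2P f).
Qed.

(** The left creation operator e_w -> e_(iw), acting in every component. *)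
Definition shift i f : fock R := L2 (shift_mem i f).

Lemma shift_norm i f : fdot (shift i f) (shift i f) = fdot f f.
Proof.
rewrite !l2_normE sqmod_shift.
by have [] := finsum_inj (@add_letterK i) (@drop_letterK i) (l2P f).
Qed.

Let unshift_sum i f (A : seq fock_index) : uniq A ->
  \sum_(p <- A) sqmod (f (add_letter i p)) <= finsum (fun p => sqmod (f p)).
Proof.
move=> uA; have := finsum_ge (l2P f) (A := map (add_letter i) A).
rewrite big_map; apply; rewrite map_inj_uniq //.
exact: (pcan_inj (@add_letterK i)).
Qed.

Lemma unshift_mem i f : (fun p => f (add_letter i p)) \in @l2_mem R fock_index.
Proof.
apply/asboolP; apply: nonneg_summableP => [p|]; first exact: sqmod_ge0.
by eexists; exact: unshift_sum.
Qed.

(** The adjoint of [shift i]: it removes a leading letter i and kills all other words. *)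
Definition unshift i f : fock R := L2 (unshift_mem i f).

Lemma unshift_norm i f : fdot (unshift i f) (unshift i f) <= fdot f f.
Proof.
rewrite !l2_normE; apply: finsum_le => [p|]; [exact: sqmod_ge0|exact: unshift_sum].
Qed.

Lemma unshiftE i f j w : unshift i f (j, w) = f (j, i :: w). Proof. by []. Qed.

Lemma shiftE i f j k w : shift i f (j, k :: w) = if k == i then f (j, w) else 0.
Proof. by rewrite /shift /= /shift_fun /drop_letter /=; case: eqP. Qed.

Lemma shift_nil i f j : shift i f (j, [::]) = 0. Proof. by []. Qed.

Lemma unshiftK i f : unshift i (shift i f) = f.
Proof. by apply: l2_eqP => -[j w]; rewrite unshiftE shiftE eqxx. Qed.

Lemma unshift_shift_neq i k f : i != k -> unshift i (shift k f) = 0.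
Proof. by move=> /negPf ik; apply: l2_eqP => -[j w]; rewrite unshiftE shiftE ik. Qed.

Lemma shiftD i f g : shift i (f + g) = shift i f + shift i g.
Proof.
apply: l2_eqP => -[j [|k w]]; rewrite l2D ?shift_nil ?addr0 // !shiftE.
by case: ifP; rewrite ?addr0.
Qed.

Lemma shiftZ i (c : R[i]) f : shift i (c *: f) = c *: shift i f.
Proof.
apply: l2_eqP => -[j [|k w]]; rewrite l2Z ?shift_nil ?mulr0 // !shiftE.
by case: ifP; rewrite ?mulr0.
Qed.

Lemma unshiftD i f g : unshift i (f + g) = unshift i f + unshift i g.
Proof. exact: l2_eqP. Qed.

Lemma unshiftZ i (c : R[i]) f : unshift i (c *: f) = c *: unshift i f.
Proof. exact: l2_eqP. Qed.

Lemma shiftB i f g : shift i (f - g) = shift i f - shift i g.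
Proof. by rewrite shiftD -scaleN1r shiftZ scaleN1r. Qed.

Lemma unshiftB i f g : unshift i (f - g) = unshift i f - unshift i g.
Proof. exact: l2_eqP. Qed.

(** Against [shift i f] only words beginning with i count, so g' may be replaced by
    [shift i (unshift i g')]; the isometry of the shift, polarized, then removes both shifts. *)
Lemma shift_adj i f g : cdot fdot (shift i f) g = cdot fdot f (unshift i g).
Proof.
have h g' : fdot (shift i f) g' = fdot f (unshift i g').
  have -> : fdot (shift i f) g' = fdot (shift i f) (shift i (unshift i g')).
    apply: l2_dot_termwise => -[j [|k w]]; rewrite ?shift_nil ?mul0r // !shiftE.
    by case: eqVneq => [->|_]; rewrite ?mul0r.
  suff: fdot (shift i f + shift i (unshift i g'))
     (shift i f + shift i (unshift i g')) =
    fdot (f + unshift i g') (f + unshift i g').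
    by rewrite !(normD hF) !shift_norm; lra.
  by rewrite -shiftD shift_norm.
by rewrite /cdot !h.
Qed.

Lemma shift_adjr i f g : cdot fdot f (shift i g) = cdot fdot (unshift i f) g.
Proof. by rewrite [LHS](cdotC hF) shift_adj [RHS](cdotC hF). Qed.

Lemma shift_inner i f g : cdot fdot (shift i f) (shift i g) = cdot fdot f g.
Proof. by rewrite shift_adj unshiftK. Qed.

Lemma shift_orth i k f g : i != k -> cdot fdot (shift i f) (shift k g) = 0.
Proof. by move=> ik; rewrite shift_adj unshift_shift_neq // (cdot0r hF). Qed.

Definition shiftw w f : fock R := foldr shift f w.

Lemma shiftwZ w (c : R[i]) f : shiftw w (c *: f) = c *: shiftw w f.
Proof. by elim: w => //= i w ->; rewrite shiftZ. Qed.

(** Common first letters cancel by isometry, distinct ones give orthogonal ranges, and when one word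
    is exhausted first the hypothesis applies. *)
Lemma wandering_gram f : (forall i w, cdot fdot (shift i (shiftw w f)) f = 0) ->
  forall v w, cdot fdot (shiftw v f) (shiftw w f) = (v == w)%:R * (fdot f f)%:C%C.
Proof.
move=> fw; elim=> [|i v ih] [|k w] /=.
- by rewrite (cdotvv hF) mul1r.
- by rewrite (cdotC hF) fw conjc0 mul0r.
- by rewrite fw mul0r.
rewrite eqseq_cons; have [->|ik] := eqVneq i k; first by rewrite shift_inner ih.
by rewrite shift_orth // mul0r.
Qed.

End shifts.

(** * Kernel vectors *)

Section kernel_vectors.
Variable R : realType.
Implicit Types (z : nat -> R[i]) (f g : fock R) (i j : nat) (w : seq nat).
Let hF := l2_hilbert R fock_index.

Definition upow z w : R[i] := \prod_(i <- w) z i.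

Definition sqsum z n : R := \sum_(0 <= i < n) sqmod (z i).

(** q is the squared norm of z, given as the supremum of the partial sums. *)
Definition in_ball z (q : R) : Prop :=
  [/\ q < 1, forall n, sqsum z n <= q & forall e, 0 < e -> exists n, q - e < sqsum z n].

Lemma sqmodJ (c : R[i]) : sqmod (conjc c) = sqmod c.
Proof. by case: c => a b; rewrite /sqmod /= sqrrN. Qed.

Lemma ler_sum_sub (T : eqType) (A B : seq T) (p : T -> R) :
  uniq A -> {subset A <= B} -> (forall t, 0 <= p t) ->
  \sum_(t <- A) p t <= \sum_(t <- B) p t.
Proof.
move=> + + p0; elim: A B => [|a A ih] B /=; first by rewrite big_nil sumr_ge0.
move=> /andP[aA uA] AB; rewrite big_cons (perm_big _ (perm_to_rem (AB a _))) ?mem_head //.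
rewrite big_cons lerD2l; apply: ih => // t tA; apply: rem_mem.
  by apply: contraNneq aA => <-.
by apply: AB; rewrite inE tA orbT.
Qed.

(** Words of length at most n in letters below m. Such boxes absorb every finite set of words and,
    unlike arbitrary finite sets, obey a recursion on the first letter. *)
Fixpoint word_box m n : seq (seq nat) :=
  if n is n'.+1 then [::] :: [seq i :: w | i <- iota 0 m, w <- word_box m n']
  else [:: [::]].

Lemma mem_word_box m n w : all (fun i => i < m)%N w -> (size w <= n)%N ->
  w \in word_box m n.
Proof.
elim: n w => [|n ih] [|i w] //= /andP[im wm] wn.
rewrite inE /=; apply/allpairsP; exists (i, w); split=> //=; last exact: ih.
by rewrite mem_iota.
Qed.

Lemma word_box_cover (A : seq (seq nat)) : exists m n, {subset A <= word_box m n}.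
Proof.
suff [m [n h]] : exists m n, forall w, w \in A ->
    all (fun i => i < m)%N w /\ (size w <= n)%N.
  by exists m, n => w /h[]; exact: mem_word_box.
elim: A => [|w A [m [n h]]]; first by exists 0%N, 0%N.
exists (maxn m (\max_(i <- w) i).+1), (maxn n (size w)) => v.
rewrite inE => /orP[/eqP ->|/h[vm vn]]; split; last by rewrite leq_max vn.
- apply/allP => i iw; rewrite leq_max ltnS; apply/orP; right.
  exact: leq_bigmax_seq.
- by rewrite leq_max leqnn orbT.
by apply: sub_all vm => i im; rewrite leq_max im.
Qed.

Lemma upow_cons z i w : upow z (i :: w) = z i * upow z w.
Proof. by rewrite /upow big_cons. Qed.

(** Splitting off the first letter bounds the sums by iterating t -> 1 + q t, whose fixed point is
    (1 - q)^-1. *)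
Lemma upow_box_le z q m n : in_ball z q ->
  \sum_(w <- word_box m n) sqmod (upow z w) <= (1 - q)^-1.
Proof.
move=> [q1 zq _]; have q0 : 0 <= q by have := zq 0%N; rewrite /sqsum big_geq.
have one : sqmod (upow z [::]) = 1.
  by rewrite /upow big_nil /sqmod /= expr1n expr0n addr0.
elim: n => [|n ih] /=; first by rewrite big_seq1 one invf_ge1; lra.
rewrite big_cons one big_allpairs_dep /=.
under eq_bigr do under eq_bigr do rewrite upow_cons sqmodM.
under eq_bigr do rewrite -mulr_sumr.
rewrite -mulr_suml.
have -> : (1 - q)^-1 = 1 + q * (1 - q)^-1 by field; lra.
rewrite lerD2l; apply: ler_pM => //.
- by apply: sumr_ge0 => i _; exact: sqmod_ge0.
- by apply: sumr_ge0 => i _; exact: sqmod_ge0.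
by have := zq m; rewrite /sqsum /index_iota subn0.
Qed.

Let kap_fun z j : fock_index -> R[i]^o :=
  fun p => if p.1 == j then conjc (upow z p.2) else 0.

Lemma kap_sum z q j (A : seq fock_index) : in_ball z q -> uniq A ->
  \sum_(p <- A) sqmod (kap_fun z j p) <= (1 - q)^-1.
Proof.
move=> zq uA; pose B := [seq p.2 | p <- A & p.1 == j].
have uB : uniq B.
  rewrite map_inj_in_uniq ?filter_uniq // => -[a v] [b w].
  by rewrite !mem_filter /= => /andP[/eqP -> _] /andP[/eqP -> _] ->.
have -> : \sum_(p <- A) sqmod (kap_fun z j p) = \sum_(w <- B) sqmod (upow z w).
  rewrite big_map big_filter [RHS]big_mkcond; apply: eq_bigr => p _.
  by rewrite /kap_fun; case: ifP => _; rewrite ?sqmodJ ?sqmod0.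
have [m [n BS]] := word_box_cover B.
apply: le_trans (upow_box_le m n zq); apply: ler_sum_sub => // w.
exact: sqmod_ge0.
Qed.

Lemma kap_mem z q j : in_ball z q -> kap_fun z j \in @l2_mem R fock_index.
Proof.
move=> zq; apply/asboolP; apply: nonneg_summableP => [p|]; first exact: sqmod_ge0.
by exists (1 - q)^-1 => A uA; exact: kap_sum.
Qed.

(* The reproducing kernel of component [j] at the point [z]. *)
Definition kap z q (zq : in_ball z q) j : fock R := L2 (kap_mem j zq).

Section one_point.
Variables (z : nat -> R[i]) (q : R) (zq : in_ball z q).
Local Notation kz := (kap zq).

Lemma kapE j i w : kz j (i, w) = if i == j then conjc (upow z w) else 0.
Proof. by []. Qed.

Lemma kap_nil j i : kz j (i, [::]) = (i == j)%:R.
Proof. by rewrite kapE /upow big_nil conjc1; case: eqP. Qed.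

Lemma unshift_kap i j : unshift i (kz j) = conjc (z i) *: kz j.
Proof.
apply: l2_eqP => -[k w]; rewrite unshiftE l2Z !kapE upow_cons rmorphM.
by case: eqP => // _; rewrite mulr0.
Qed.

(** Kernel vectors are eigenvectors of the adjoint shifts; hence shifts become scalar
    multiplications under evaluation. *)
Lemma cdot_shift_kap i j f :
  cdot fdot (shift i f) (kz j) = z i * cdot fdot f (kz j).
Proof. by rewrite shift_adj unshift_kap (cdotZr hF) conjcK. Qed.

Lemma cdot_shiftw_kap w j f :
  cdot fdot (shiftw w f) (kz j) = upow z w * cdot fdot f (kz j).
Proof.
elim: w => [|i w ih] /=; first by rewrite /upow big_nil mul1r.
by rewrite cdot_shift_kap ih upow_cons mulrA.
Qed.

Lemma cdot_delta_kap i w j :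
  cdot fdot (l2_delta R (i, w)) (kz j) = if i == j then upow z w else 0.
Proof.
by rewrite (cdotC hF) cdot_delta kapE; case: eqP; rewrite ?conjcK ?conjc0.
Qed.

Lemma cdot_kap_comp0 f j : (forall w, f (j, w) = 0) -> cdot fdot f (kz j) = 0.
Proof.
move=> f0; apply: l2_cdot_eq0 => -[i w]; rewrite kapE.
by case: eqVneq => [->|_]; rewrite ?f0 ?mul0r // conjc0 mulr0.
Qed.

Lemma kap_norm_le j : fdot (kz j) (kz j) <= (1 - q)^-1.
Proof.
rewrite l2_normE; apply: finsum_le => [p|A uA]; [exact: sqmod_ge0|exact: kap_sum].
Qed.

(* [kz j] minus its projection on the constants and the ranges of the first [n]
   shifts; letting it tend to zero gives <kap_y, kap_x> = 1 + u(x)u(y)^* <kap_y, kap_x>. *)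
Fixpoint kap_tail j n : fock R :=
  if n is n'.+1 then kap_tail j n' - conjc (z n') *: shift n' (kz j)
  else kz j - l2_delta R (j, [::]).

Lemma unshift_kap_tail j n i : (n <= i)%N ->
  unshift i (kap_tail j n) = conjc (z i) *: kz j.
Proof.
elim: n => [|n ih] /= ni; rewrite unshiftB.
  rewrite unshift_kap; suff -> : unshift i (l2_delta R (j, [::])) = 0 by rewrite subr0.
  by apply: l2_eqP => -[k w]; rewrite unshiftE l2_deltaE xpair_eqE andbF.
by rewrite ih ?(ltnW ni) // unshiftZ unshift_shift_neq ?gtn_eqF // scaler0 subr0.
Qed.

(** The vectors removed are mutually orthogonal projections of [kz j]: the constant, of norm 1, and
    for each shift i < n one of squared norm |z i|^2 |kz j|^2. *)
Lemma kap_tail_norm j n :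
  fdot (kap_tail j n) (kap_tail j n) = fdot (kz j) (kz j) * (1 - sqsum z n) - 1.
Proof.
elim: n => [|n ih] /=.
  rewrite (normD hF) (normN hF) (dotNr hF) l2_delta_norm /sqsum big_geq //.
  by rewrite [fdot _ (l2_delta _ _)]cdot_Re cdot_delta kap_nil eqxx /=; ring.
rewrite (normD hF) (normN hF) (dotNr hF) ih (sqnormZ hF) sqmodJ shift_norm.
rewrite [fdot (kap_tail j n) _]cdot_Re.
have -> : cdot fdot (kap_tail j n) (conjc (z n) *: shift n (kz j)) =
    (sqmod (z n) * fdot (kz j) (kz j))%:C%C.
  rewrite (cdotZr hF) conjcK (cdotC hF) shift_adj unshift_kap_tail //.
  rewrite (cdotZr hF) conjcK (cdotvv hF); case: (z n) => a b.
  by rewrite /sqmod; apply/eqP; rewrite eq_complex /=; apply/andP; split; apply/eqP; ring.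
by rewrite /sqsum big_nat_recr //=; ring.
Qed.

Lemma cdot_kap_tail j n f : cdot fdot f (kap_tail j n) =
  cdot fdot f (kz j) - f (j, [::]) -
    \sum_(0 <= i < n) z i * cdot fdot f (shift i (kz j)).
Proof.
elim: n => [|n ih] /=; first by rewrite big_geq // subr0 (cdotBr hF) cdot_delta.
by rewrite (cdotBr hF) ih (cdotZr hF) conjcK big_nat_recr //= opprD addrA.
Qed.

(** By [kap_norm_le], the norm formula is at most (1 - q)^-1 (1 - sqsum z n) - 1, which tends to 0
    as the partial sums approach q. *)
Lemma kap_tail_cvg j e : 0 < e -> exists N, forall n, (N <= n)%N ->
  fdot (kap_tail j n) (kap_tail j n) < e.
Proof.
move=> e0; case: (zq) => q1 zle zlim.
have d0 : 0 < e * (1 - q) by rewrite mulr_gt0 //; lra.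
have [N hN] := zlim _ d0; exists N => n Nn.
have zn : q - e * (1 - q) < sqsum z n.
  apply: lt_le_trans hN _; rewrite /sqsum [leRHS](big_cat_nat (leq0n N) Nn) /= lerDl.
  by apply: sumr_ge0 => i _; exact: sqmod_ge0.
rewrite kap_tail_norm; have := kap_norm_le j; set N2 := fdot _ _ => hN2.
have : N2 * (1 - sqsum z n) <= (1 - q)^-1 * (1 - sqsum z n).
  by rewrite ler_wpM2r //; have := zle n; lra.
have : (1 - q)^-1 * (1 - sqsum z n) < (1 - q)^-1 * ((1 - q) * (1 + e)).
  by rewrite ltr_pM2l ?invr_gt0; lra.
by rewrite mulKf; lra.
Qed.

End one_point.

Lemma cdot_kap_neq z q (zq : in_ball z q) z' q' (zq' : in_ball z' q') i j :
  i != j -> cdot fdot (kap zq i) (kap zq' j) = 0.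
Proof.
by move=> /negPf ij; apply: cdot_kap_comp0 => w; rewrite kapE eq_sym ij.
Qed.

Lemma cvg_complexP (s : nat -> R[i]^o) (l : R[i]) :
  (forall e, 0 < e -> exists N, forall n, (N <= n)%N -> sqmod (l - s n) < e) ->
  s @ \oo --> (l : R[i]^o).
Proof.
(* A positive e in [R[i]] has imaginary part 0. *)
move=> h; apply/cvgrPdist_lt => e; rewrite ltcE /= => /andP[/eqP e_im e0].
have [N hN] := h _ (exprn_gt0 2 e0); exists N => // n /= Nn.
have -> : e = (complex.Re e)%:C%C by rewrite [LHS]complexE e_im mulr0 addr0.
rewrite normc_def ltcR -(ltr_pXn2r (n := 2)) ?nnegrE ?sqrtr_ge0 ?(ltW e0) //.
by rewrite sqr_sqrtr ?hN // addr_ge0 ?sqr_ge0.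
Qed.

(** With c the left side and S n the partial sums of the pairing, c - 1 - S n c is a product with
    [kap_tail] and tends to 0. So c is nonzero and S n tends to (c - 1) / c: the series converges,
    and its value determines c. *)
Lemma cdot_kap z q (zq : in_ball z q) z' q' (zq' : in_ball z' q') j :
  cdot fdot (kap zq' j) (kap zq j) = 1 / (1 - pairing_l2 z z').
Proof.
set c := cdot _ _ _; pose S n := \sum_(0 <= i < n) z i * conjc (z' i).
have Sc e : 0 < e -> exists N, forall n, (N <= n)%N -> sqmod (c - 1 - S n * c) < e.
  move=> e0; pose M := fdot (kap zq' j) (kap zq' j).
  have M0 : 0 <= M := dot_ge0 hF _.
  have d0 : 0 < e / (2 * (M + 1)) by rewrite divr_gt0 //; lra.
  have [N hN] := kap_tail_cvg zq j d0; exists N => n /hN Dn.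
  have -> : c - 1 - S n * c = cdot fdot (kap zq' j) (kap_tail zq j n).
    rewrite cdot_kap_tail kap_nil eqxx; congr (_ - _ - _).
    rewrite /S mulr_suml; apply: eq_bigr => i _.
    by rewrite shift_adjr unshift_kap (cdotZl hF) mulrA.
  apply: le_lt_trans (sqmod_cdot_le hF _ _) _; rewrite -/M.
  move: Dn; rewrite ltr_pdivlMr; last lra.
  set D := fdot _ _; have D0 : 0 <= D := dot_ge0 hF _.
  lra.
have c0 : c != 0.
  apply/eqP => c0; have [N] := Sc 1 ltr01; move=> /(_ N (leqnn N)).
  by rewrite c0 mulr0 sub0r subr0 sqmodN /sqmod /= expr1n expr0n addr0 ltxx.
have Slim : series (fun i => z i * (z' i)^* : R[i]^o) @ \oo --> ((c - 1) / c : R[i]^o).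
  apply: cvg_complexP => e e0.
  have cp : 0 < sqmod c.
    by rewrite lt_def sqmod_ge0 andbT; apply: contra_neq c0; exact: sqmod_eq0.
  have [N hN] := Sc _ (mulr_gt0 e0 cp); exists N => n /hN.
  have -> : c - 1 - S n * c = ((c - 1) / c - S n) * c by field.
  by rewrite sqmodM ltr_pM2r.
rewrite /pairing_l2 (cvg_lim (@norm_hausdorff _ _) Slim).
have -> : 1 - (c - 1) / c = c^-1 by field.
by rewrite div1r invrK.
Qed.

End kernel_vectors.

(** * Wold decomposition *)

Section wold.
Variables (R : realType) (F E : fock R).
Let hF := l2_hilbert R fock_index.
Local Notation cl := (dot_closure fdot).

Definition shift_span : set (fock R) := family_span (fun w => shiftw w F).
Definition proper_shift_span : set (fock R) :=
  family_span (fun p : fock_index => shift p.1 (shiftw p.2 F)).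

Let M_sub : real_subspace shift_span := family_span_real_subspace _.
Let N_sub : real_subspace proper_shift_span := family_span_real_subspace _.

Lemma shift_closed_span i f : cl shift_span f -> cl proper_shift_span (shift i f).
Proof.
move: f; apply: dot_closure_map => [u v|s]; first by rewrite -shiftB shift_norm.
move: s; apply: (family_span_min (S := [set s | proper_shift_span (shift i s)])).
  split=> [|t u v hu hv] /=.
    by rewrite -(scale0r 0) shiftZ scale0r; exact: real_span0.
  rewrite shiftD shiftZ; apply: (real_subspaceD N_sub) => //.
  exact: (real_subspaceZ _ N_sub).
move=> c w /=; rewrite shiftZ.
exact: (mem_family_span (fun p : fock_index => shift p.1 (shiftw p.2 F)) c (i, w)).
Qed.

Lemma proper_shift_span_sub : cl proper_shift_span `<=` cl shift_span.
Proof.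
apply: dot_closureS; apply: (family_span_min M_sub) => c [i w] /=.
exact: (mem_family_span (fun w => shiftw w F) c (i :: w)).
Qed.

Lemma shiftw_closed_span w f : cl shift_span f -> cl shift_span (shiftw w f).
Proof.
move=> hf; elim: w => [|i w ih]; first exact: hf.
exact: proper_shift_span_sub (shift_closed_span i ih).
Qed.

Lemma unshift_span i f : proper_shift_span f -> shift_span (unshift i f).
Proof.
move: f; apply: (family_span_min (S := [set f | shift_span (unshift i f)])).
  split=> [|t u v hu hv] /=.
    have -> : unshift i (0 : fock R) = 0 by exact: l2_eqP.
    exact: real_span0.
  rewrite unshiftD unshiftZ; apply: (real_subspaceD M_sub) => //.
  exact: (real_subspaceZ _ M_sub).
move=> c [k w] /=; rewrite unshiftZ; have [->|ik] := eqVneq i k.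
  by rewrite unshiftK; exact: (mem_family_span (fun w => shiftw w F)).
by rewrite unshift_shift_neq // scaler0; exact: real_span0.
Qed.

Lemma proper_shift_nil f j : cl proper_shift_span f -> f (j, [::]) = 0.
Proof.
move=> hf; rewrite -cdot_delta; apply: (family_span_orth hF) hf => -[i w].
by rewrite cdot_delta.
Qed.

Hypothesis FE : cl proper_shift_span (F - E).
Hypothesis E_orth : forall i w, cdot fdot E (shift i (shiftw w F)) = 0.

Lemma wandering_nil j : E (j, [::]) = F (j, [::]).
Proof. by apply/eqP; rewrite eq_sym -subr_eq0 -l2N -l2D (proper_shift_nil _ FE). Qed.

Lemma proper_shift_orth f : cl proper_shift_span f -> cdot fdot f E = 0.
Proof.
apply: (family_span_orth hF) => -[i w] /=.
by rewrite (cdotC hF) E_orth conjc0.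
Qed.

Lemma wandering_mem : cl shift_span E.
Proof.
have -> : E = F - (F - E) by rewrite subKr.
apply: (real_subspaceB (dot_closure_subspace hF M_sub)); last exact: proper_shift_span_sub.
by apply: (subset_dot_closure hF); exact: (family_mem (fun w => shiftw w F) [::]).
Qed.

Lemma wandering_orth i w : cdot fdot (shift i (shiftw w E)) E = 0.
Proof.
apply: proper_shift_orth; apply: shift_closed_span; apply: shiftw_closed_span.
exact: wandering_mem.
Qed.

Lemma shift_span_split s : shift_span s ->
  exists c s', proper_shift_span s' /\ s = c *: F + s'.
Proof.
move: s; apply: (family_span_min
  (S := [set s | exists c s', proper_shift_span s' /\ s = c *: F + s'])).
  split=> [|t _ _ [c [u [hu ->]]] [d [v [hv ->]]]].
    by exists 0, 0; split; [exact: real_span0 | rewrite scale0r addr0].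
  exists (c + t%:C%C * d), (u + t%:C%C *: v); split; first by case: N_sub => _; exact.
  by rewrite scalerDr scalerA scalerDl addrACA.
move=> c [|i w]; first by exists c, 0; split; [exact: real_span0 | rewrite addr0].
exists 0, (c *: shiftw (i :: w) F); rewrite scale0r add0r; split=> //.
exact: (mem_family_span (fun p : fock_index => shift p.1 (shiftw p.2 F)) c (i, w)).
Qed.

(** Approximate D by c F + s' and replace c F by c (F - E). The new approximant is orthogonal to E,
    like D, so dropping the term c E can only shorten the difference. *)
Lemma shift_span_orth D : cl shift_span D -> cdot fdot D E = 0 -> cl proper_shift_span D.
Proof.
move=> hD DE; apply: (dot_closure_idem hF) => e e0.
have [s /shift_span_split[c [s' [hs' ->]]] Ds] := hD _ e0.
have h : cl proper_shift_span (c *: (F - E) + s').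
  apply: (real_subspaceD (dot_closure_subspace hF N_sub)).
    exact (closed_spanZ hF c FE).
  exact (subset_dot_closure hF hs').
exists (c *: (F - E) + s'); first exact h.
apply: le_lt_trans Ds.
have -> : D - (c *: F + s') = (D - (c *: (F - E) + s')) - c *: E.
  by rewrite scalerBr -[RHS]addrA -opprD addrAC subrK.
have o : cdot fdot (D - (c *: (F - E) + s')) (- (c *: E)) = 0.
  rewrite -scaleNr (cdotZr hF) (cdotBl hF) DE (proper_shift_orth h).
  by rewrite subr0 mulr0.
by rewrite (pythagoras hF o) lerDl (dot_ge0 hF).
Qed.

(* Wold decomposition: the shifts of [E] span the invariant subspace generated
   by [F], since the coefficients of an orthogonal vector vanish one length of
   words after the other. *)
Lemma wold D : cl shift_span D -> (forall v, cdot fdot D (shiftw v E) = 0) -> D = 0.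
Proof.
move=> hD DE; apply: l2_eq0 => -[j w].
elim: w D hD DE => [|i w ih] D hD DE.
  exact: proper_shift_nil (shift_span_orth hD (DE [::])).
have hN := shift_span_orth hD (DE [::]).
rewrite -unshiftE; apply: ih => [|v]; last by rewrite -shift_adjr (DE (i :: v)).
move: hN; apply: dot_closure_map => [u v|s]; last exact: unshift_span.
by rewrite -unshiftB unshift_norm.
Qed.

End wold.

Lemma exists_wandering (R : realType) (F : fock R) :
  exists E, dot_closure fdot (proper_shift_span F) (F - E) /\
    forall i w, cdot fdot E (shift i (shiftw w F)) = 0.
Proof.
have [p [hp orth]] := hilbert_proj (l2_hilbert R fock_index)
  (fun p : fock_index => shift p.1 (shiftw p.2 F)) F.
exists (F - p); split; first by rewrite subKr.
by move=> i w; exact: (orth (i, w)).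
Qed.

(** * Reproducing kernel Hilbert spaces and the factorization *)

Section limits.
Variables (R : realType) (V : lmodType R[i]) (r : V -> V -> R).
Hypothesis hr : hilbert r.
Implicit Types (u v : V) (s p : nat -> V).

Lemma cdot_suml p (n : nat) v :
  cdot r (\sum_(0 <= i < n) p i) v = \sum_(0 <= i < n) cdot r (p i) v.
Proof. by elim/big_rec2: _ => [|i a b _ <-]; rewrite ?(cdot0l hr) ?(cdotDl hr). Qed.

Lemma norm_orth_sum p m n : (forall i j, i != j -> cdot r (p i) (p j) = 0) ->
  r (\sum_(m <= i < n) p i) (\sum_(m <= i < n) p i) = \sum_(m <= i < n) r (p i) (p i).
Proof.
move=> orth; have [mn|/ltnW nm] := leqP m n; last by rewrite !big_geq // (dot0l hr).
rewrite -(subnKC mn); elim: (n - m)%N => [|d ih]; first by rewrite addn0 !big_geq // (dot0l hr).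
rewrite addnS !big_nat_recr ?leq_addr //= (pythagoras hr) ?ih //.
rewrite (cdotC hr) (cdot_sumr hr) big_nat big1 ?conjc0 // => i /andP[_ im].
by apply: orth; rewrite neq_ltn im orbT.
Qed.

(** Each [p i] is a projection of z; expand |z - S|^2 >= 0 for their sum S. *)
Lemma bessel z p n : (forall i j, i != j -> cdot r (p i) (p j) = 0) ->
  (forall i, cdot r (z - p i) (p i) = 0) -> \sum_(0 <= i < n) r (p i) (p i) <= r z z.
Proof.
move=> orth zp; pose S := \sum_(0 <= i < n) p i.
have h0 := dot_ge0 hr (z - S).
have zS : r z S = \sum_(0 <= i < n) r (p i) (p i).
  have -> : r z S = complex.Re (cdot r z S) by [].
  rewrite /S (cdot_sumr hr).
  have -> : \sum_(0 <= i < n) cdot r z (p i) = (\sum_(0 <= i < n) r (p i) (p i))%:C%C.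
    rewrite rmorph_sum; apply: eq_bigr => i _ /=; rewrite -(cdotvv hr).
    by apply/eqP; rewrite -subr_eq0 -(cdotBl hr) zp.
  by [].
have SS : r S S = \sum_(0 <= i < n) r (p i) (p i) by exact: norm_orth_sum.
by move: h0; rewrite (normD hr) (dotNr hr) (normN hr) zS SS; lra.
Qed.

Section limit.
Variables (s : nat -> V) (l : V).
Hypothesis sl : forall e, 0 < e -> exists N, forall n, (N <= n)%N -> r (s n - l) (s n - l) < e.

Lemma cdot_lim v c : (exists N, forall n, (N <= n)%N -> cdot r (s n) v = c) ->
  cdot r l v = c.
Proof.
move=> [N hN]; apply/eqP; rewrite -subr_eq0; apply/eqP; apply: sqmod_eq0.
apply: le_anti; rewrite sqmod_ge0 andbT.
have v0 := dot_ge0 hr v.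
apply: (@le0_mulP _ _ (2 * r v v)) => [|e e0]; first lra.
have [N' hN'] := sl e0; have hn := hN' (maxn N N') (leq_maxr _ _).
rewrite -(hN (maxn N N') (leq_maxl _ _)) -(cdotBl hr) -[_ - _]opprB (cdotNl hr) sqmodN.
by have := sqmod_cdot_le hr (s (maxn N N') - l) v; have := ler_wpM2r v0 (ltW hn); lra.
Qed.

Lemma norm_lim_le M : (forall n, r (s n) (s n) <= M) -> r l l <= M.
Proof.
move=> sM; have M0 : 0 <= M by apply: le_trans (sM 0%N); exact: dot_ge0.
apply: (le_addmul M0) => d d0.
have di0 : 0 < d^-1 by rewrite invr_gt0.
apply: (@le_addmul _ _ _ (1 + d^-1)) => [|e e0]; first lra.
have [N /(_ N (leqnn N)) hN] := sl e0.
have := normD_young hr (s N) (l - s N) d0; rewrite addrC subrK => h.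
apply: le_trans h _; rewrite (norm_distC hr).
apply: lerD; last by rewrite mulrC ler_wpM2r ?ltW //; lra.
by have := sM N; have := ler_wpM2l (ltW d0) (sM N); lra.
Qed.

End limit.

(** The partial sums of squared norms increase to their supremum, which makes the series Cauchy.
    Coefficients are asked to be eventually constant, as happens when v meets a single term. *)
Lemma orthogonal_series p M : (forall i j, i != j -> cdot r (p i) (p j) = 0) ->
  (forall n, \sum_(0 <= i < n) r (p i) (p i) <= M) ->
  exists2 f, r f f <= M & forall v c,
    (exists N, forall n, (N <= n)%N -> \sum_(0 <= i < n) cdot r (p i) v = c) ->
    cdot r f v = c.
Proof.
move=> orth pM; pose s n := \sum_(0 <= i < n) p i.
pose a n := \sum_(0 <= i < n) r (p i) (p i).
have hs : has_sup (range a).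
  by split; [exists (a 0%N); exists 0%N | exists M => _ [n _ <-]; exact: pM].
have diff m n : (m <= n)%N -> r (s m - s n) (s m - s n) = a n - a m.
  move=> mn; rewrite /s /a (big_cat_nat (leq0n m) mn) /= [in RHS](big_cat_nat (leq0n m) mn) /=.
  by rewrite opprD addNKr (normN hr) (norm_orth_sum _ _ orth) addrAC subrr add0r.
have [l hl] : exists l, forall e, 0 < e -> exists N, forall n, (N <= n)%N ->
    r (s n - l) (s n - l) < e.
  apply: (dot_complete hr) => e e0.
  have [_ [N _ <-] hN] := sup_adherent e0 hs.
  have aN n : (N <= n)%N -> sup (range a) - e < a n <= sup (range a).
    move=> Nn; apply/andP; split; last first.
      by apply: ub_le_sup; [case: hs | exists n].
    by apply: lt_le_trans hN _; have := diff _ _ Nn; have := dot_ge0 hr (s N - s n); lra.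
  exists N => m n /aN /andP[m1 m2] /aN /andP[n1 n2].
  have [mn|/ltnW nm] := leqP m n; first by rewrite diff //; lra.
  by rewrite (norm_distC hr) diff //; lra.
exists l; first by apply: (norm_lim_le hl) => n; rewrite norm_orth_sum.
move=> v c [N hN]; apply: (cdot_lim hl); exists N => n /hN <-.
exact: cdot_suml.
Qed.

End limits.

(** * The Hilbert space H(k) *)

Section rkhs_hilbert.
Variables (R : realType) (Omega : Type) (k : Omega -> Omega -> R[i]) (H : rkhs k).
Implicit Types (f g : H) (x y : Omega).

Definition rkhs_rdot f g : R := complex.Re (rkhs_dot H f g).

Lemma rkhs_normE f : hnorm f ^+ 2 = rkhs_rdot f f.
Proof.
rewrite /rkhs_rdot -rkhs_dotE /hnorm.
have : 0 <= `|f| by [].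
by rewrite lecE => /andP[/eqP h _]; rewrite [in RHS](complexE `|f|) h mulr0 addr0 -rmorphXn.
Qed.

Lemma hnorm_ge0 f : 0 <= hnorm f.
Proof. by have : 0 <= `|f| by []; rewrite lecE => /andP[]. Qed.

Lemma rkhs_dotZl (c : R[i]) f g : rkhs_dot H (c *: f) g = c * rkhs_dot H f g.
Proof. by rewrite linearZl_LR. Qed.

Lemma rkhs_dotC f g : rkhs_dot H g f = conjc (rkhs_dot H f g).
Proof. by rewrite hermC expr0 mul1r. Qed.

Lemma rkhs_dotZr (c : R[i]) f g : rkhs_dot H f (c *: g) = conjc c * rkhs_dot H f g.
Proof. by rewrite [LHS]rkhs_dotC rkhs_dotZl rmorphM [in RHS]rkhs_dotC. Qed.

Lemma rkhs_complete (s : nat -> H) :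
  (forall e, 0 < e -> exists N, forall m n, (N <= m)%N -> (N <= n)%N ->
     rkhs_rdot (s m - s n) (s m - s n) < e) ->
  exists l, forall e, 0 < e -> exists N, forall n, (N <= n)%N ->
     rkhs_rdot (s n - l) (s n - l) < e.
Proof.
have normE (f : H) (e : R) : 0 < e -> (`|f| < e%:C%C) = (rkhs_rdot f f < e ^+ 2).
  move=> e0; rewrite -rkhs_normE ltr_pXn2r ?nnegrE ?hnorm_ge0 ?ltW //.
  have : 0 <= `|f| by [].
  rewrite lecE => /andP[/eqP h _].
  by rewrite ltcE h /= eqxx.
move=> hs; have sc : cvgn s.
  apply: cauchy_cvg; apply: cauchy_exP => e; rewrite ltcE /= => /andP[/eqP e_im e0].
  have [N hN] := hs _ (exprn_gt0 2 e0); exists (s N), N => // n /= Nn.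
  rewrite -ball_normE /=; have -> : e = (complex.Re e)%:C%C.
    by rewrite [LHS]complexE e_im mulr0 addr0.
  by rewrite normE //; exact: hN.
exists (limn s) => e e0.
have se0 : 0 < Num.sqrt e by rewrite sqrtr_gt0.
have /cvgrPdist_lt/(_ (Num.sqrt e)%:C%C) [|N _ hN] := sc; first by rewrite ltcR.
exists N => n /hN /=; rewrite normE // sqr_sqrtr ?ltW // -opprB => h.
by move: h; rewrite -!rkhs_normE /hnorm normrN.
Qed.

Lemma rkhs_hilbert : hilbert rkhs_rdot.
Proof.
split; rewrite /rkhs_rdot; last exact: rkhs_complete.
- by move=> f g; rewrite [in RHS]rkhs_dotC; case: (rkhs_dot H f g).
- move=> f g h; rewrite linearDl /=.
  by case: (rkhs_dot H f h) => a b; case: (rkhs_dot H g h).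
- by move=> t f g; rewrite rkhs_dotZl; case: (rkhs_dot H f g) => a b /=; ring.
- by move=> f g; rewrite rkhs_dotZl rkhs_dotZr; case: (rkhs_dot H f g) => a b /=; ring.
by move=> f; have := dnorm_ge0 (rkhs_dot H) f; rewrite lecE => /andP[].
Qed.

Lemma cdot_ker f x : cdot rkhs_rdot f (rkhs_ker H x) = rkhs_fun H f x.
Proof.
rewrite rkhs_reproducing /cdot /rkhs_rdot rkhs_dotZr.
case: (rkhs_dot H f _) => a b; congr (_ +i* _)%C => /=; ring.
Qed.

End rkhs_hilbert.

(** * Reduction of both kinds of unit ball to that of l^2(N) *)

Section ball.
Variable R : realType.

Lemma sqmod_normE (z : R[i]) : (complex.Re `|z|) ^+ 2 = sqmod z.
Proof. by rewrite normc_def /= sqr_sqrtr // addr_ge0 ?sqr_ge0. Qed.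

Lemma in_ball_l2 (z : nat -> R[i]) : ball_l2 z -> exists q, in_ball z q.
Proof.
rewrite /ball_l2; under eq_eseriesr do rewrite sqmod_normE.
set S := (\sum_(0 <= j <oo) _)%E => S1.
have z0 n : (0 <= n)%N -> xpredT n -> (0%:E <= (sqmod (z n))%:E)%E.
  by move=> _ _; rewrite lee_fin sqmod_ge0.
have S0 : (0 <= S)%E by apply: nneseries_ge0.
have Sf : S = (fine S)%:E.
  by rewrite fineK // ge0_fin_numE // (lt_trans S1) // ltry.
have le_S n : ((sqsum z n)%:E <= S)%E.
  by rewrite /sqsum -sumEFin; apply: nneseries_lim_ge.
exists (fine S); split.
- by rewrite -lte_fin -Sf.
- by move=> n; rewrite -lee_fin -Sf.
move=> e e0; apply: contrapT => hn.
suff : (S <= (fine S - e)%:E)%E by rewrite [X in (X <= _)%E]Sf lee_fin; lra.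
apply: lime_le; first exact: is_cvg_nneseries.
apply: nearW => n; rewrite sumEFin lee_fin leNgt; apply/negP => h.
by apply: hn; exists n.
Qed.

(** Padding with 0 embeds C^d in l^2(N), preserving norms and pairings. *)
Definition extend_fin d (z : 'rV[R[i]]_d) (j : nat) : R[i] :=
  if insub j is Some i then z 0 i else 0.

Lemma sum_extend_fin (V : zmodType) d (z : 'rV[R[i]]_d) (F : R[i] -> nat -> V) n :
  (d <= n)%N -> (forall j, F 0 j = 0) ->
  \sum_(0 <= j < n) F (extend_fin z j) j = \sum_(j < d) F (z 0 j) j.
Proof.
move=> dn F0; rewrite (big_cat_nat (leq0n d) dn) /= big_mkord.
rewrite [X in _ + X]big_nat [X in _ + X]big1 ?addr0.
  by apply: eq_bigr => j _; rewrite /extend_fin valK.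
by move=> j /andP[dj _]; rewrite /extend_fin insubF ?F0 // ltnNge dj.
Qed.

Lemma in_ball_fin d (z : 'rV[R[i]]_d) : ball_fin z -> exists q, in_ball (extend_fin z) q.
Proof.
move=> zb; pose q := \sum_(j < d) sqmod (z 0 j).
have sE n : (d <= n)%N -> sqsum (extend_fin z) n = q.
  move=> dn; rewrite /sqsum (@sum_extend_fin R d z (fun c _ => sqmod c)) //.
  by move=> _; exact: sqmod0.
exists q; split.
- have -> : q = complex.Re (\sum_(j < d) `|z 0 j| ^+ 2).
    rewrite -[q]/(complex.Re q%:C%C) rmorph_sum; congr complex.Re.
    by apply: eq_bigr => j _; rewrite -add_Re2_Im2.
  by move: zb; rewrite /ball_fin ltcE => /andP[].
- move=> n; rewrite -(sE (maxn d n) (leq_maxl _ _)) /sqsum.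
  rewrite [leRHS](big_cat_nat (leq0n n) (leq_maxr d n)) /= lerDl.
  by apply: sumr_ge0 => j _; exact: sqmod_ge0.
by move=> e e0; exists d; rewrite sE //; lra.
Qed.

Lemma pairing_extend_fin d (z w : 'rV[R[i]]_d) :
  pairing_l2 (extend_fin z) (extend_fin w) = pairing_fin z w.
Proof.
suff h : series (fun j => extend_fin z j * (extend_fin w j)^* : R[i]^o) @ \oo -->
    (pairing_fin z w : R[i]^o).
  by rewrite /pairing_l2 (cvg_lim (@norm_hausdorff _ _) h).
apply: cvg_complexP => e e0; exists d => n dn.
suff -> : series (fun j => extend_fin z j * (extend_fin w j)^* : R[i]^o) n =
    pairing_fin z w by rewrite subrr sqmod0.
rewrite /series /= (@sum_extend_fin R[i] d z (fun c j => c * conjc (extend_fin w j))) //.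
  by apply: eq_bigr => j _; rewrite /extend_fin valK.
by move=> j; rewrite mul0r.
Qed.

Lemma normalized_CNP_ball (Omega : Type) (k : Omega -> Omega -> R[i]) :
  normalized_CNP k -> exists (u : Omega -> nat -> R[i]) (q : Omega -> R),
    (forall x, in_ball (u x) (q x)) /\
    forall x y, k x y = 1 / (1 - pairing_l2 (u x) (u y)).
Proof.
case=> [[d [u [ub uk]]]|[u [ub uk]]].
  have [q uq] := choice (fun x => in_ball_fin (ub x)).
  exists (fun x => extend_fin (u x)), q; split=> // x y.
  by rewrite pairing_extend_fin.
by have [q uq] := choice (fun x => in_ball_l2 (ub x)); exists u, q.
Qed.

End ball.

(** * From an isometric column on F^2 to a contractive column of multipliers *)

Section factorization.
Variables (R : realType) (Omega : Type) (k : Omega -> Omega -> R[i]) (H : rkhs k).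
Variables (u : Omega -> nat -> R[i]) (q : Omega -> R).
Hypothesis uq : forall x, in_ball (u x) (q x).
Hypothesis ku : forall x y, k x y = 1 / (1 - pairing_l2 (u x) (u y)).
Implicit Types (x y : Omega) (f : H).
Let hF := l2_hilbert R fock_index.
Let hH := rkhs_hilbert H.
Local Notation hdot := (@rkhs_rdot R Omega k H).
Local Notation K x j := (kap (uq x) j).
Local Notation delta := (l2_delta R).

Lemma kernel_gram j x y :
  cdot hdot (rkhs_ker H x) (rkhs_ker H y) = cdot fdot (K x j) (K y j).
Proof. by rewrite cdot_ker rkhs_kerE ku (cdot_kap (uq y) (uq x)). Qed.

(** The isometric embedding of H(k) into component j. The closed span is recorded because it makes
    lifts to distinct components orthogonal. *)
Lemma rkhs_lift f j : exists g : fock R,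
  [/\ dot_closure fdot (family_span (fun x => K x j)) g, fdot g g <= hdot f f &
    forall x, cdot fdot g (K x j) = rkhs_fun H f x].
Proof.
have [g [hg n1 gE]] := transfer hH hF f (kernel_gram j).
by exists g; split=> // x; rewrite gE cdot_ker.
Qed.

(** The adjoint of the embedding into component j, hence contractive. *)
Lemma rkhs_push (g : fock R) j : exists f : H,
  hdot f f <= fdot g g /\ forall x, rkhs_fun H f x = cdot fdot g (K x j).
Proof.
have [f [_ n1 fE]] := transfer hF hH g (fun x y => esym (kernel_gram j x y)).
by exists f; split=> // x; rewrite -cdot_ker fE.
Qed.

Lemma component_orth i j (f g : fock R) : i != j ->
  dot_closure fdot (family_span (fun x => K x i)) f ->
  dot_closure fdot (family_span (fun x => K x j)) g -> cdot fdot f g = 0.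
Proof.
move=> ij hf hg; apply: (family_span_orth hF) hf => x.
rewrite (cdotC hF) (_ : cdot _ _ _ = 0) ?conjc0 //.
by apply: (family_span_orth hF) hg => y; apply: cdot_kap_neq; rewrite eq_sym.
Qed.

(** The projections of z on the embedded copies of H(k) are mutually orthogonal, so Bessel's
    inequality bounds all the entries together. *)
Lemma rkhs_push_seq (z : fock R) : exists f : nat -> H,
  (forall j x, rkhs_fun H (f j) x = cdot fdot z (K x j)) /\
  forall n, \sum_(0 <= j < n) hdot (f j) (f j) <= fdot z z.
Proof.
have hp j : exists p : fock R * H,
   [/\ dot_closure fdot (family_span (fun x => K x j)) p.1,
     cdot fdot (z - p.1) p.1 = 0, hdot p.2 p.2 <= fdot p.1 p.1 &
     forall x, rkhs_fun H p.2 x = cdot fdot z (K x j)].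
  have gram := fun x y => esym (kernel_gram j x y).
  have [p [hp orth _ n2]] := graph_proj hF hH z gram.
  exists p; split=> [||//|x]; first exact: graph_fst hp.
    rewrite (cdotC hF) (_ : cdot _ _ _ = 0) ?conjc0 //.
    apply: (family_span_orth hF) (graph_fst hH hp) => x.
    by rewrite (cdotC hF) orth conjc0.
  rewrite -cdot_ker -(graph_cdot_eq hF hH (u := K x j) _ hp) => [|y]; last exact: gram.
  by apply/eqP; rewrite eq_sym -subr_eq0 -(cdotBl hF) orth.
have [p pP] := choice hp; exists (fun j => (p j).2); split=> [j x|n].
  by case: (pP j).
apply: (@le_trans _ _ (\sum_(0 <= j < n) fdot (p j).1 (p j).1)).
  by apply: ler_sum => j _; case: (pP j).
apply: (bessel hF) => [i j ij|j]; last by case: (pP j).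
by apply: component_orth ij _ _; [case: (pP i)|case: (pP j)].
Qed.

Section contractive_column.
Variable E : fock R.
Hypothesis E_gram : forall v w,
  cdot fdot (shiftw v E) (shiftw w E) = (v == w)%:R.

Lemma delta_gram v w :
  cdot fdot (delta (0%N, v)) (delta (0%N, w)) = cdot fdot (shiftw v E) (shiftw w E).
Proof. by rewrite cdot_delta l2_deltaE E_gram xpair_eqE eqxx eq_sym. Qed.

(** Lift f to component 0, send each word w there to [shiftw w E], and evaluate in every component:
    an isometric lift, a partial isometry and a contraction. A word contributes u(x)^w times the
    evaluation of E, whence the product. *)
Lemma column_operator f : exists g : nat -> H,
  (forall j x, rkhs_fun H (g j) x = cdot fdot E (K x j) * rkhs_fun H f x) /\
  forall n, \sum_(0 <= j < n) hdot (g j) (g j) <= hdot f f.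
Proof.
have [f' [_ n1 f'E]] := rkhs_lift f 0.
have [p [hp orth n2 n3]] := graph_proj hF hF f' delta_gram.
have [g [gE gn]] := rkhs_push_seq p.2; exists g; split=> [j x|n]; last first.
  by apply: le_trans (gn n) _; apply: le_trans n3 _; apply: le_trans n2 _.
rewrite gE -f'E.
have -> : cdot fdot f' (K x 0) = cdot fdot p.1 (K x 0).
  apply/eqP; rewrite -subr_eq0 -(cdotBl hF); apply/eqP; apply: cdot_kap_comp0 => w.
  by rewrite -cdot_delta orth.
pose c := cdot fdot E (K x j).
(* Both [conjc c *: K x 0] against the word w and [K x j] against [shiftw w E] give c u(x)^w. *)
rewrite -(graph_cdot_eq hF hF (u := conjc c *: K x 0) _ hp) => [|w].
  by rewrite (cdotZr hF) conjcK.
by rewrite (cdotZr hF) conjcK cdot_delta_kap eqxx cdot_shiftw_kap mulrC.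
Qed.

Lemma column_multiplier : exists c : nat -> multiplier H,
  (forall j x, c j x = cdot fdot E (K x j)) /\
  forall f n, \sum_(0 <= j < n) hdot (mult_op (c j) f) (mult_op (c j) f) <= hdot f f.
Proof.
have [g gP] := choice column_operator.
have bounded j : exists M : R, forall f, hnorm (g f j) <= M * hnorm f.
  exists 1 => f; rewrite mul1r -(ler_pXn2r (n := 2)) ?nnegrE ?hnorm_ge0 //.
  rewrite !rkhs_normE; apply: le_trans ((gP f).2 j.+1); rewrite big_nat_recr //= lerDr.
  by apply: sumr_ge0 => i _; exact: (dot_ge0 hH).
exists (fun j => Multiplier (fun f x => (gP f).1 j x) (bounded j)); split=> // f n.
exact: (gP f).2.
Qed.

End contractive_column.

End factorization.

(** * The column F and its inner-outer factorization *)

Section outer_factor.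
Variables (R : realType) (Omega : Type) (k : Omega -> Omega -> R[i]) (H : rkhs k).
Variables (u : Omega -> nat -> R[i]) (q : Omega -> R).
Hypothesis uq : forall x, in_ball (u x) (q x).
Hypothesis ku : forall x y, k x y = 1 / (1 - pairing_l2 (u x) (u y)).
Implicit Types (x y : Omega) (f : H).
Let hF := l2_hilbert R fock_index.
Let hH := rkhs_hilbert H.
Local Notation hdot := (@rkhs_rdot R Omega k H).
Local Notation K x j := (kap (uq x) j).
Local Notation delta := (l2_delta R).

Lemma column_vector (h : nat -> H) (S : R) :
  (forall n, \sum_(0 <= i < n) hdot (h i) (h i) <= S) ->
  exists F : fock R, [/\ fdot F F <= 1 + S, F (0%N, [::]) = 1,
    forall x, cdot fdot F (K x 0) = 1 &
    forall j x, cdot fdot F (K x j.+1) = rkhs_fun H (h j) x].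
Proof.
move=> hS; have [g gP] := choice (fun j => rkhs_lift uq ku (h j) j.+1).
(* Entry 0 is the constant 1 and [h i] sits in component i + 1; the same numbering later gives a and
   [b i]. *)
pose G j := if j is i.+1 then g i else delta (0%N, [::]).
have g0 j : g j (0%N, [::]) = 0.
  rewrite -cdot_delta; case: (gP j) => hg _ _; apply: (family_span_orth hF) hg => x.
  by rewrite cdot_delta kap_nil.
have orth i j : i != j -> cdot fdot (G i) (G j) = 0.
  case: i j => [|i] [|j] //= ij.
  - by rewrite (cdotC hF) cdot_delta g0 conjc0.
  - by rewrite cdot_delta g0.
  by apply: (component_orth (uq := uq) ij); [case: (gP i)|case: (gP j)].
have GK i j x : i != j -> cdot fdot (G i) (K x j) = 0.
  case: i => [|i] ij; first by rewrite cdot_delta_kap (negPf ij).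
  by case: (gP i) => hg _ _; apply: (family_span_orth hF) hg => y; exact: cdot_kap_neq.
have bound n : \sum_(0 <= i < n) fdot (G i) (G i) <= 1 + S.
  apply: (@le_trans _ _ (\sum_(0 <= i < n.+1) fdot (G i) (G i))).
    by rewrite big_nat_recr //= lerDl (dot_ge0 hF).
  rewrite big_nat_recl //= l2_delta_norm lerD2l; apply: le_trans (hS n).
  by apply: ler_sum => i _; case: (gP i).
have [F nF FE] := orthogonal_series hF orth bound.
have pick (a : nat -> R[i]) j : (forall i, i != j -> a i = 0) ->
    exists N, forall n, (N <= n)%N -> \sum_(0 <= i < n) a i = a j.
  move=> a0; exists j.+1 => n jn.
  by rewrite (bigD1_seq j) ?iota_uniq ?mem_index_iota //= big1 ?addr0.
exists F; split=> //.
- rewrite -cdot_delta; apply: FE.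
  have [|N hN] := pick (fun i => cdot fdot (G i) (delta (0%N, [::]))) 0%N.
    by move=> i i0; exact: (orth i 0%N).
  by exists N => n /hN ->; rewrite /= cdot_delta l2_deltaE eqxx.
- move=> x; apply: FE.
  have [|N hN] := pick (fun i => cdot fdot (G i) (K x 0)) 0%N; first by move=> i /GK.
  by exists N => n /hN ->; rewrite /= cdot_delta_kap /upow big_nil.
move=> j x; apply: FE.
have [|N hN] := pick (fun i => cdot fdot (G i) (K x j.+1)) j.+1; first by move=> i /GK.
by exists N => n /hN ->; case: (gP j) => _ _ ->.
Qed.

(* The inner-outer factorization [F = E g] of the column [F] over the Fock
   space, evaluated at the points of [Omega]. *)
Lemma inner_outer (F : fock R) : F (0%N, [::]) = 1 ->
  exists E g : fock R, [/\
    forall v w, cdot fdot (shiftw v E) (shiftw w E) = (v == w)%:R,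
    dot_closure fdot (shift_span F) E,
    fdot g g <= fdot F F &
    forall x, cdot fdot F (K x 0) = cdot fdot E (K x 0) * cdot fdot g (K x 0)].
Proof.
move=> F1; have [D [FD D_orth]] := exists_wandering F.
have D_gram := wandering_gram (wandering_orth FD D_orth).
have D1 : D (0%N, [::]) = 1 by rewrite (wandering_nil FD).
have nD : 1 <= fdot D D.
  by have := l2_coord_le D (0%N, [::]); rewrite D1 /sqmod /= expr1n expr0n addr0.
have nD0 : 0 < fdot D D by lra.
pose t := Num.sqrt (fdot D D); have t0 : 0 < t by rewrite sqrtr_gt0.
have tt : t ^+ 2 = fdot D D by rewrite sqr_sqrtr // ltW.
pose E := t^-1%:C%C *: D.
have E_gram v w : cdot fdot (shiftw v E) (shiftw w E) = (v == w)%:R.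
  rewrite /E !shiftwZ (cdotZl hF) (cdotZr hF) conjc_real D_gram.
  have ttt : t^-1%:C%C * (t^-1%:C%C * (t ^+ 2)%:C%C) = 1 :> R[i].
    by rewrite -!rmorphM -[1](rmorph1 (real_complex R)); congr (_%:C%C); field; rewrite gt_eqF.
  by rewrite -tt !(mulrCA _ (v == w)%:R) ttt mulr1.
have hM : real_subspace (dot_closure fdot (shift_span F)).
  exact (dot_closure_subspace hF (family_span_real_subspace _)).
have E_mem : dot_closure fdot (shift_span F) E.
  exact (real_subspaceZ _ hM (wandering_mem FD)).
have gram v w : cdot fdot (shiftw v E) (shiftw w E) =
    cdot fdot (delta (0%N, v)) (delta (0%N, w)).
  by rewrite cdot_delta l2_deltaE E_gram xpair_eqE eqxx eq_sym.
have [p [hp orth n1 n2]] := graph_proj hF hF F gram.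
have Fp : F - p.1 = 0.
  apply: (wold FD D_orth) => [|v].
    apply: (real_subspaceB hM).
      apply: (subset_dot_closure hF); exact: (family_mem (fun w => shiftw w F) [::]).
    have := graph_fst hF hp; move: p.1 => p1 hp1.
    apply: (dot_closure_idem hF); move: hp1; apply: dot_closureS => s.
    apply: (family_span_min hM) => c w.
    exact (closed_spanZ hF c (shiftw_closed_span w E_mem)).
  (* [wold] speaks of the unnormalized D, while [orth] speaks of E; the factor between them
     cancels. *)
  apply: (mulfI (_ : t^-1%:C%C != 0)).
    by rewrite fmorph_eq0 invr_eq0 gt_eqF.
  by rewrite mulr0 -(conjc_real t^-1) -(cdotZr hF) -shiftwZ orth.
exists E, p.2; split=> // [|x]; first exact: le_trans n2 n1.
have -> : F = p.1 by apply/eqP; rewrite -subr_eq0 Fp.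
rewrite (graph_cdot_eq hF hF (v := conjc (cdot fdot E (K x 0)) *: K x 0) _ hp) => [|w].
  by rewrite (cdotZr hF) conjcK.
by rewrite (cdotZr hF) conjcK cdot_delta_kap eqxx cdot_shiftw_kap mulrC.
Qed.

(* If [a g = 1] then the range of [a] contains [a (p g) = p] for every
   polynomial [p] in the coordinates of [u], and these are dense. *)
Lemma outer_of_inverse (a : multiplier H) (g : fock R) :
  (forall x, a x * cdot fdot g (K x 0) = 1) -> outer a.
Proof.
move=> ag O [h Oh] Oopen.
have /nbhs_ballP [e /= e0 he] : nbhs h O by exact: open_nbhs_nbhs.
have [f [_ _ fE]] := rkhs_lift uq ku h 0.
(* [f - p] vanishes on component 0, so it is invisible to [K x 0]; p in turn is a limit of
   polynomials s. *)
have [p [hp orth]] := hilbert_proj hF (fun w => delta (0%N, w)) f.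
move: e0; rewrite ltcE /= => /andP[/eqP e_im e0].
have [s hs ps] := hp _ (exprn_gt0 2 e0).
have [d [nd dE]] := rkhs_push H uq ku (p - s) 0.
(* r is the product s g: each word w of the polynomial s contributes a multiple of [shiftw w g]. *)
have [r rE] : exists r : fock R, forall x,
    cdot fdot r (K x 0) = cdot fdot s (K x 0) * cdot fdot g (K x 0).
  move: s hs {ps d nd dE}; apply: (family_span_min (S := [set s | exists r : fock R,
    forall x, cdot fdot r (K x 0) = cdot fdot s (K x 0) * cdot fdot g (K x 0)])).
    split=> [|t s s' [r hr] [r' hr']].
      by exists 0 => x; rewrite !(cdot0l hF) mul0r.
    exists (r + t%:C%C *: r') => x.
    by rewrite !(cdotDl hF) !(cdotZl hF) hr hr' mulrDl mulrA.
  move=> c w; exists (c *: shiftw w g) => x.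
  by rewrite !(cdotZl hF) cdot_shiftw_kap cdot_delta_kap eqxx mulrA.
have [m [_ mE]] := rkhs_push H uq ku r 0.
have am : mult_op a m = h - d.
  apply: (rkhs_fun_inj (r := H)); apply/funext => x.
  rewrite mult_opE mE rE mulrCA ag mulr1.
  rewrite -(cdot_ker (h - d)) (cdotBl hH) !cdot_ker dE -fE (cdotBl hF).
  suff -> : cdot fdot f (K x 0) = cdot fdot p (K x 0) by rewrite subKr.
  apply/eqP; rewrite -subr_eq0 -(cdotBl hF); apply/eqP; apply: cdot_kap_comp0 => w.
  by rewrite -cdot_delta orth.
exists (h - d); split; last by exists m.
apply: he; rewrite -ball_normE /= subKr ltcE e_im.
have : 0 <= `|d| by []; rewrite lecE => /andP[/eqP -> _]; rewrite eqxx /=.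
rewrite -[_ < _]/(hnorm d < complex.Re e) -(ltr_pXn2r (n := 2)) ?nnegrE ?hnorm_ge0 ?(ltW e0) //.
by rewrite rkhs_normE; exact: le_lt_trans nd ps.
Qed.

End outer_factor.

Theorem corollary3p4 (R : realType) (Omega : Type)
    (k : Omega -> Omega -> R[i]) (hk : normalized_CNP k)
    (H : rkhs k) (h : nat -> H)
    (hh : (\sum_(0 <= i <oo) (hnorm (h i) ^+ 2)%:E < +oo)%E) :
  exists (a : multiplier H) (b : nat -> multiplier H),
    [/\ outer a,
        (forall x, a x != 0) /\
          (forall i x, rkhs_fun H (h i) x = b i x / a x),
        (forall f : H,
          ((hnorm (mult_op a f) ^+ 2)%:E
             + \sum_(0 <= i <oo) (hnorm (mult_op (b i) f) ^+ 2)%:E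
           <= (hnorm f ^+ 2)%:E)%E) &
        exists g : H,
          (forall x, rkhs_fun H g x = 1 / a x) /\
          ((hnorm g ^+ 2)%:E
             <= 1%:E + \sum_(0 <= i <oo) (hnorm (h i) ^+ 2)%:E)%E].
Proof.
have [u [q [uq ku]]] := normalized_CNP_ball hk.
pose K x j := kap (uq x) j.
have hF := l2_hilbert R fock_index.
have sq0 (f : nat -> H) n : (0 <= n)%N -> xpredT n -> (0%:E <= (hnorm (f n) ^+ 2)%:E)%E.
  by move=> _ _; rewrite lee_fin sqr_ge0.
have SE : (\sum_(0 <= i <oo) (hnorm (h i) ^+ 2)%:E)%E =
    (fine (\sum_(0 <= i <oo) (hnorm (h i) ^+ 2)%:E)%E)%:E.
  by rewrite fineK // ge0_fin_numE //; apply: nneseries_ge0 => n; exact: sq0.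
move: SE; set S := fine _ => SE.
have hS n : \sum_(0 <= i < n) rkhs_rdot (h i) (h i) <= S.
  rewrite -lee_fin -SE -sumEFin; under eq_bigr do rewrite -rkhs_normE.
  by apply: nneseries_lim_ge => i; exact: sq0.
have [F [nF F1 FK0 FK]] := column_vector uq ku hS.
have [E [g [E_gram E_mem ng FEg]]] := inner_outer uq F1.
have [c [cE cn]] := column_multiplier H uq ku E_gram.
have ag x : c 0%N x * cdot fdot g (K x 0%N) = 1 by rewrite cE -FEg FK0.
have a0 x : c 0%N x != 0.
  by apply: contra_eq_neq (ag x) => ->; rewrite mul0r eq_sym oner_neq0.
exists (c 0%N), (fun i => c i.+1); split.
- exact: (outer_of_inverse ku ag).
- split=> // i x; apply: (mulIf (a0 x)); rewrite divfK // !cE.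
  (* Against [shiftw w F] the two terms of v give u(x)^w times h_i(x) and h_i(x) times u(x)^w times
     1; so v is orthogonal to every shift of F, hence to E. *)
  pose v := K x i.+1 - conjc (rkhs_fun H (h i) x) *: K x 0%N.
  have : cdot fdot E v = 0.
    apply: (family_span_orth hF) E_mem => w.
    rewrite (cdotBr hF) (cdotZr hF) conjcK !cdot_shiftw_kap FK FK0.
    by rewrite mulr1 mulrC subrr.
  by rewrite (cdotBr hF) (cdotZr hF) conjcK => /eqP; rewrite subr_eq0 => /eqP ->.
- move=> f; pose N j := (hnorm (mult_op (c j) f) ^+ 2)%:E.
  have N0 j : (0%:E <= N j)%E by rewrite lee_fin sqr_ge0.
  have fin0 : (N 0%N \is a fin_num)%E by [].
  (* Isolating the series reduces the claim to its partial sums: n entries [b i] together with a are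
     the first n + 1 entries of the column. *)
  rewrite -[X in (X + _ <= _)%E]/(N 0%N) addeC -leeBrDr //.
  apply: lime_le; first by apply: is_cvg_nneseries => n _ _; exact: (N0 n.+1).
  apply: nearW => n; rewrite leeBrDr // sumEFin -EFinD lee_fin addrC.
  have := cn f n.+1; rewrite big_nat_recl //= !rkhs_normE.
  by under [X in _ -> _ + X <= _]eq_bigr do rewrite rkhs_normE.
have [G [nG GE]] := rkhs_push H uq ku g 0.
exists G; split=> [x|].
  by rewrite GE div1r; apply: (mulfI (a0 x)); rewrite ag mulfV.
rewrite SE -EFinD lee_fin rkhs_normE; apply: le_trans nG _.
exact: le_trans ng nF.
Qed.
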